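(* (a) Let $\Gamma$ be a torus graph. Then the simplicial poset $\mathcal P(\Gamma)$ is a pseudomanifold, and the face ring $\mathbb Z[\mathcal P(\Gamma)]$ admits an lsop. (b) Given an arbitrary $(n-1)$-dimensional pseudomanifold $\mathcal P$ and an lsop in $\mathbb Z[\mathcal P]$, one can canonically construct a torus graph $\Gamma_{\mathcal P}$; namely, the graph $\Gamma_{\mathcal P}$ together with the function $\alpha$ described in the context (and a suitable connection) is a torus graph. Moreover, $\Gamma_{\mathcal P(\Gamma)}=\Gamma$ for every torus graph $\Gamma$, where $\Gamma_{\mathcal P(\Gamma)}$ is constructed from the canonical lsop of $\mathbb Z[\mathcal P(\Gamma)]$ described in the context.
   Context: Torus graphs. Let $T=T^n$ be the $n$-dimensional torus; $H^2(BT)=\mathrm{Hom}(T,S^1)\cong\mathbb Z^n$ with dual $H_2(BT)$, and $H^*(BT)$ is the polynomial ring on $H^2(BT)$. Let $\Gamma$ be a finite connected regular $n$-valent graph without loops (multiple edges allowed), $V(\Gamma)$ its vertices, $E(\Gamma)$ its oriented edges (each edge occurs with both orientations), $i(e),t(e)$ the initial and terminal vertices, $\bar e$ the reversed edge, $E(\Gamma)_p=\{e: i(e)=p\}$. A connection $\theta$ is a collection of bijections $\theta_e\colon E(\Gamma)_{i(e)}\to E(\Gamma)_{t(e)}$ with $\theta_{\bar e}=\theta_e^{-1}$ and $\theta_e(e)=\bar e$. A torus axial function is a map $\alpha\colon E(\Gamma)\to H^2(BT)$ such that (i) $\alpha(\bar e)=\pm\alpha(e)$; (ii) $\alpha(E(\Gamma)_p)$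 is a basis of $H^2(BT)$ for each vertex $p$; (iii) $\alpha(\theta_e(e'))\equiv\alpha(e')\bmod\alpha(e)$ for all $e$ and $e'\in E(\Gamma)_{i(e)}$. The triple $(\Gamma,\alpha,\theta)$ is a torus graph; $\theta$ is determined by $\alpha$. A $k$-face of $\Gamma$ is a connected regular $k$-valent subgraph invariant under $\theta$ ($0\le k\le n$); facets are $(n-1)$-faces. Simplicial posets. A finite poset $\mathcal P$ is simplicial if it has an initial element $\hat 0$ and each lower segment $[\hat0,\sigma]$ is a boolean lattice; $\mathrm{rk}\,\sigma=k$ if $[\hat 0,\sigma]$ is the face poset of a $(k-1)$-simplex, and $\sigma$ is then called a $(k-1)$-simplex. $\sigma\vee\tau$ and $\sigma\wedge\tau$ denote the sets of minimal common upper bounds and maximal common lower bounds. The face ring is $\mathbf k[\mathcal P]=\mathbf k[v_\sigma:\sigma\in\mathcal P\setminus\hat0]/\mathcal I_{\mathcal P}$, $\deg v_\sigma=2\,\mathrm{rk}\,\sigma$, where $\mathcal I_{\mathcal P}$ is generated by $v_\sigma v_\tau-v_{\sigma\wedge\tau}\sum_{\eta\in\sigma\vee\tau}v_\eta$ ($v_{\hat0}=1$; $\sigma\wedge\tau$ is a single element if $\sigma\vee\tau\neq\varnothing$; empty sums are $0$). For $\mathcal P$ of rank $n$, an lsop (linear system of parameters) in $\mathbf k[\mathcal P]$ is a sequence $\theta_1,\dots,\theta_n$ of algebraically independent degree-two elements such that $\mathbf k[\mathcal P]$ is a finitely generated $\mathbf k[\theta_1,\dots,\theta_n]$-module. The faces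 of $\Gamma$ ordered by reversed inclusion form a simplicial poset $\mathcal P(\Gamma)$ of rank $n$ (a face $F$ has rank $n-\dim F$; vertices of $\mathcal P(\Gamma)$ are the facets of $\Gamma$). A simplicial poset $\mathcal P$ is an $(n-1)$-dimensional pseudomanifold if: (1) every $\sigma\in\mathcal P$ is $\le$ some element of rank $n$, and $n$ is the rank of $\mathcal P$; (2) every element of rank $n-1$ is $<$ exactly two elements of rank $n$; (3) any two elements $\tau,\tau'$ of rank $n$ are connected by a sequence $\tau=\tau_1,\dots,\tau_k=\tau'$ of rank-$n$ elements such that $\tau_i\wedge\tau_{i+1}$ contains an element of rank $n-1$ for each $i$. Construction of $\Gamma_{\mathcal P}$. Let $\mathcal P$ be an $(n-1)$-dimensional pseudomanifold with vertices (rank one elements) $v_1,\dots,v_m$, and let an lsop be given, regarded as a homomorphism $\lambda\colon H^*(BT)\to\mathbb Z[\mathcal P]$ sending a basis of $H^2(BT)$ to the lsop; write $\lambda(t)=\sum_{i=1}^m\lambda_i(t)v_i$ for $t\in H^2(BT)$, with $\lambda_i\in H_2(BT)$. Vertices of $\Gamma_{\mathcal P}$ are the $(n-1)$-simplices of $\mathcal P$, and the edges between $\sigma$ and $\sigma'$ correspond to the $(n-2)$-simplices in $\sigma\wedge\sigma'$. For a vertex $p$ let $I(p)\subset\{1,\dots,m\}$ be the set of indices of the vertices of the corresponding $(n-1)$-simplex ($|I(p)|=n$). For an oriented edge $e$ with $i(e)=p$ let $\ell\in I(p)$ be the vertex not in the $(n-2)$-simplex corresponding to $e$; $\alpha(e)\in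 H^2(BT)$ is defined by $\langle\alpha(e),\lambda_i\rangle=\delta_{i\ell}$ for $i\in I(p)$. Canonical lsop of $\mathbb Z[\mathcal P(\Gamma)]$. $\mathbb Z[\mathcal P(\Gamma)]$ is identified with the ring $H_T^*(\Gamma)$ of maps $f\colon V(\Gamma)\to H^*(BT)$ with $f(i(e))\equiv f(t(e))\bmod\alpha(e)$ for all $e$, the generator $v_F$ corresponding to the map $\tau_F$ with $\tau_F(p)=\prod_{i(e)=p,\,e\notin F}\alpha(e)$ for $p\in F$ and $\tau_F(p)=0$ for $p\notin F$. The canonical lsop consists of the constant maps with values in a basis of $H^2(BT)$, i.e. $\lambda\colon H^*(BT)\to H^*_T(\Gamma)$ sends $t$ to the constant map $t$. *)

(* Defs.v *)
From HB Require Import structures.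
From mathcomp Require Import all_boot all_order all_algebra.
From mathcomp Require Import ring_quotient.
From mathcomp Require Import boolp.
From mathcomp Require Import mpoly.

Set Implicit Arguments.
Unset Strict Implicit.
Unset Printing Implicit Defensive.

Import Order.TTheory GRing.Theory Num.Theory.
Local Open Scope ring_scope.
Local Open Scope quotient_scope.

(* Conventions: T is the torus of dimension n with fixed coordinates, so that *)
(* H^2(BT) = 'rV[int]_n, H_2(BT) = 'cV[int]_n and H^*(BT) = {mpoly int[n]}.   *)

Definition pairing n (a : 'rV[int]_n) (l : 'cV[int]_n) : int := (a *m l) 0 0.

Definition lin n (a : 'rV[int]_n) : {mpoly int[n]} := \sum_(j < n) a 0 j *: 'X_j.

Definition is_Zbasis n (I : finType) (A : {set I}) (b : I -> 'rV[int]_n) : Prop :=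
  (forall x : 'rV[int]_n, exists c : I -> int, x = \sum_(i in A) c i *: b i) /\
  (forall c : I -> int,
     \sum_(i in A) c i *: b i = 0 -> forall i, i \in A -> c i = 0).

(* Finite graphs without loops, multiple edges allowed.  [edge] is the type   *)
(* of oriented edges; t(e) is the source of the reversed edge.                *)

Record mgraph : Type := MGraph {
  vert : finType;
  edge : finType;
  src : edge -> vert;
  rev : edge -> edge;
  revK : involutive rev;
  loopless : forall e, src (rev e) != src e
}.

Section Graphs.
Variable G : mgraph.

Definition tgt (e : edge G) : vert G := src (rev e).

Definition star (p : vert G) : {set edge G} := [set e | src e == p].

Definition adj (F : {set edge G}) : rel (vert G) :=
  [rel p q | [exists e in F, (src e == p) && (tgt e == q)]].

Definition graph_connected : Prop :=
  (0 < #|vert G|)%N /\ forall p q, connect (adj setT) p q.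

Definition regular (n : nat) : Prop := forall p, #|star p| = n.

(* [theta e] is only meaningful on [star (src e)]; since [rev] is involutive, *)
(* the second clause makes [theta e] and [theta (rev e)] mutually inverse     *)
(* bijections between [star (src e)] and [star (tgt e)].                      *)
Definition is_connection (theta : edge G -> edge G -> edge G) : Prop :=
  [/\ forall e e', src e' = src e -> src (theta e e') = tgt e,
      forall e e', src e' = src e -> theta (rev e) (theta e e') = e' &
      forall e, theta e e = rev e].

Definition is_axial n (theta : edge G -> edge G -> edge G)
    (alpha : edge G -> 'rV[int]_n) : Prop :=
  [/\ forall e, alpha (rev e) = alpha e \/ alpha (rev e) = - alpha e,
      forall p, is_Zbasis (star p) alpha &
      forall e e', src e' = src e ->
        exists c : int, alpha (theta e e') - alpha e' = c *: alpha e].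

End Graphs.

Definition is_torus_graph n (G : mgraph) (alpha : edge G -> 'rV[int]_n)
    (theta : edge G -> edge G -> edge G) : Prop :=
  [/\ graph_connected G, regular G n, is_connection theta & is_axial theta alpha].

Record torus_graph (n : nat) : Type := TorusGraph {
  tg_graph :> mgraph;
  axial : edge tg_graph -> 'rV[int]_n;
  conn : edge tg_graph -> edge tg_graph -> edge tg_graph;
  tg_axiom : is_torus_graph axial conn
}.

Section Faces.
Variables (n : nat) (G : torus_graph n).

(* A subgraph is given by its vertices and its oriented edges. *)
Definition is_kface (k : nat) (S : {set vert G} * {set edge G}) : bool :=
  [&& S.1 != set0,
      [forall e in S.2, (rev e \in S.2) && (src e \in S.1)],
      [forall p in S.1, forall q in S.1, connect (adj S.2) p q],
      [forall p in S.1, #|star p :&: S.2| == k] &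
      [forall e in S.2, forall e' in S.2,
         (src e' == src e) ==> (conn e e' \in S.2)]].

Definition is_face S : bool := [exists k : 'I_n.+1, is_kface k S].

Definition face : Type := {S : {set vert G} * {set edge G} | is_face S}.

HB.instance Definition _ := Finite.on face.

Definition face_verts (F : face) : {set vert G} := (val F).1.
Definition face_edges (F : face) : {set edge G} := (val F).2.

Definition face_le : rel face :=
  [rel F1 F2 | (face_verts F2 \subset face_verts F1)
               && (face_edges F2 \subset face_edges F1)].

Lemma face_le_refl : reflexive face_le.
Proof. by move=> F; rewrite /face_le /= !fintype.subxx. Qed.

Lemma face_le_anti : antisymmetric face_le.
Proof.
move=> F1 F2 /andP[/andP[h1 h2] /andP[h3 h4]]; apply: val_inj.
have e1 : face_verts F1 = face_verts F2 by apply/eqP; rewrite eqEsubset h1 h3.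
have e2 : face_edges F1 = face_edges F2 by apply/eqP; rewrite eqEsubset h2 h4.
by rewrite [LHS]surjective_pairing [RHS]surjective_pairing; congr pair.
Qed.

Lemma face_le_trans : transitive face_le.
Proof.
move=> F1 F2 F3 /andP[h1 h2] /andP[h3 h4].
by rewrite /face_le /= (subset_trans h3 h1) (subset_trans h4 h2).
Qed.

Fact face_display : Order.disp_t. Proof. exact: Order.Disp tt tt. Qed.

HB.instance Definition _ := Order.Le_isPOrder.Build face_display face
  face_le_refl face_le_anti face_le_trans.

Lemma is_face_setT : is_face (setT, setT).
Proof.
case: (tg_axiom G) => -[Gn0 Gc] Gr [Gs _ _] _.
apply/existsP; exists ord_max; apply/and5P; split.
- by rewrite -card_gt0 cardsT.
- by apply/forall_inP => e _; rewrite !inE.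
- by apply/forall_inP => p _; apply/forall_inP => q _; apply: Gc.
- by apply/forall_inP => p _; rewrite setIT Gr.
- by apply/forall_inP => e _; apply/forall_inP => e' _; apply/implyP; rewrite inE.
Qed.

Definition whole_face : face := Sub (setT, setT) is_face_setT.

Lemma whole_face_le (F : face) : (whole_face <= F)%O.
Proof. by apply/andP; rewrite !subsetT. Qed.

HB.instance Definition _ := Order.hasBottom.Build face_display face whole_face_le.

End Faces.

Section SimplicialPosets.
Variables (d : Order.disp_t) (P : finBPOrderType d).
Implicit Types s t w : P.

(* [\bot, s] is isomorphic to the face poset of a (k-1)-simplex. *)
Definition is_simplex (k : nat) (s : P) : bool :=
  [exists f : {ffun {set 'I_k} -> P},
    [forall A, forall B, (f A <= f B)%O == (A \subset B)] &&
    [forall t, (t <= s)%O == [exists A, f A == t]]].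

Definition simplicial : Prop := forall s, exists k, is_simplex k s.

(* The maximum ranges over at most one k, and over exactly one if P is       *)
(* simplicial; the bound is harmless since [is_simplex k s] gives             *)
(* k < 2 ^ k <= #|P|.                                                         *)
Definition rk (s : P) : nat := \max_(k < #|P|.+1 | is_simplex k s) k.

Definition joins (s t : P) : {set P} :=
  [set w | [&& (s <= w)%O, (t <= w)%O &
     [forall u, [&& (s <= u)%O, (t <= u)%O & (u <= w)%O] ==> (u == w)]]].

Definition meets (s t : P) : {set P} :=
  [set w | [&& (w <= s)%O, (w <= t)%O &
     [forall u, [&& (u <= s)%O, (u <= t)%O & (w <= u)%O] ==> (u == w)]]].

(* n is the rank of P, which is a pseudomanifold of dimension n-1. *)
Definition pseudomanifold (n : nat) : Prop :=
  [/\ simplicial,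
      (forall s, exists2 t, (s <= t)%O & rk t = n) /\ (forall s, (rk s <= n)%N),
      forall s, (rk s).+1 = n -> #|[set t | (s < t)%O && (rk t == n)]| = 2%N &
      forall s t, rk s = n -> rk t = n ->
        connect [rel x y | [&& rk x == n, rk y == n &
                   [exists w in meets x y, (rk w).+1 == n]]] s t].

Definition gen : finType := {s : P | s != \bot%O}.

Definition nvar : nat := #|{: gen}|.

Definition var (s : P) : {mpoly int[nvar]} :=
  if insub s is Some x then 'X_(enum_rank (x : gen)) else 1.

(* In a simplicial poset [meets s t] is a singleton as soon as [joins s t] is *)
(* nonempty, so that the first sum is then the single variable v_(s /\ t).    *)
Definition face_rel (s t : P) : {mpoly int[nvar]} :=
  var s * var t
  - (\sum_(w in meets s t) var w) * (\sum_(u in joins s t) var u).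

Definition in_face_ideal (p : {mpoly int[nvar]}) : Prop :=
  exists c : P -> P -> {mpoly int[nvar]}, p = \sum_s \sum_t c s t * face_rel s t.

Definition face_ideal : pred {mpoly int[nvar]} := fun p => `[< in_face_ideal p >].

Lemma var_bot : var \bot%O = 1.
Proof. by rewrite /var insubN // eqxx. Qed.

Lemma meets_bot t : meets \bot%O t = [set \bot%O].
Proof.
apply/setP => w; rewrite !inE lex0; apply/idP/eqP => [/and3P[/eqP]//|->].
rewrite eqxx le0x /=; apply/forallP => u; apply/implyP => /and3P[].
by rewrite lex0.
Qed.

Lemma joins_bot t : joins \bot%O t = [set t].
Proof.
apply/setP => w; rewrite !inE le0x /=; apply/idP/eqP => [/andP[tw /forallP/(_ t)]|->].
  by rewrite le0x lexx tw /= => /eqP.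
rewrite lexx /=; apply/forallP => u; apply/implyP => /and3P[_ tu ut].
by rewrite eq_le ut tu.
Qed.

Lemma meetsC s t : meets s t = meets t s.
Proof.
apply/setP => w; rewrite !inE andbCA; congr (_ && (_ && _)).
by apply: eq_forallb => u; rewrite andbCA.
Qed.

Lemma joinsC s t : joins s t = joins t s.
Proof.
apply/setP => w; rewrite !inE andbCA; congr (_ && (_ && _)).
by apply: eq_forallb => u; rewrite andbCA.
Qed.

Lemma face_relC s t : face_rel s t = face_rel t s.
Proof. by rewrite /face_rel mulrC meetsC joinsC. Qed.

Lemma face_rel_bot t : face_rel \bot%O t = 0.
Proof. by rewrite /face_rel meets_bot joins_bot !big_set1 subrr. Qed.

Lemma face_rel_eval0 s t : (face_rel s t).@[fun=> 0] = 0.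
Proof.
have v0 u : u != \bot%O -> (var u).@[fun=> 0] = 0.
  by move=> u0; rewrite /var insubT mevalXU.
have [->|s0] := eqVneq s \bot%O; first by rewrite face_rel_bot meval0.
have j0 : (\sum_(u in joins s t) var u).@[fun=> 0] = 0.
  rewrite raddf_sum /= big1 // => u; rewrite inE => /and3P[su _ _].
  by apply: v0; apply: contraNneq s0 => u0; rewrite -lex0 -u0.
by rewrite /face_rel mevalB !mevalM v0 // mul0r j0 mulr0 subrr.
Qed.

Lemma face_ideal_closed : idealr_closed face_ideal.
Proof.
split.
- by apply/asboolP; exists (fun _ _ => 0); rewrite big1 // => s _;
    rewrite big1 // => t _; rewrite mul0r.
- apply/negP => /asboolP[c] /(congr1 (meval (fun=> 0))) /eqP.
  rewrite meval1 raddf_sum big1 ?oner_eq0 // => s _ /=.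
  rewrite raddf_sum big1 // => t _ /=.
  by rewrite mevalM face_rel_eval0 mulr0.
- move=> a p q /asboolP[cp ->] /asboolP[cq ->]; apply/asboolP.
  exists (fun s t => a * cp s t + cq s t).
  rewrite mulr_sumr -big_split; apply: eq_bigr => s _ /=.
  rewrite mulr_sumr -big_split; apply: eq_bigr => t _ /=.
  by rewrite mulrDl mulrA.
Qed.

HB.instance Definition _ :=
  isIdealr.Build {mpoly int[nvar]} face_ideal face_ideal_closed.

Definition face_idealr : idealr {mpoly int[nvar]} := face_ideal.
Definition face_ring : Type := {ideal_quot face_idealr}.

HB.instance Definition _ := GRing.ComNzRing.on face_ring.

Definition face_class (p : {mpoly int[nvar]}) : face_ring := \pi_{ideal_quot face_idealr} p.

Definition fv (s : P) : face_ring := face_class (var s).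

(* The grading deg v_s = 2 rk s. *)
Definition wdeg (m : 'X_{1..nvar}) : nat :=
  \sum_(i < nvar) m i * (2 * rk (val (enum_val i : gen))).

Definition homogeneous (k : nat) (x : face_ring) : Prop :=
  exists2 p, x = face_class p & forall m, m \in msupp p -> wdeg m = k.

Definition eval_at n (th : 'I_n -> face_ring) (q : {mpoly int[n]}) : face_ring :=
  mmap intr th q.

Definition is_lsop n (th : 'I_n -> face_ring) : Prop :=
  [/\ forall j, homogeneous 2 (th j),
      forall q, eval_at th q = 0 -> q = 0 &
      exists (k : nat) (g : 'I_k -> face_ring), forall x,
        exists q : 'I_k -> {mpoly int[n]}, x = \sum_(i < k) eval_at th (q i) * g i].

(* An lsop regarded as a homomorphism H^*(BT) -> Z[P]: such a homomorphism is *)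
(* determined by its restriction [lam] to H^2(BT).                            *)
Definition is_lsop_hom n (lam : 'rV[int]_n -> face_ring) : Prop :=
  exists2 B : 'M[int]_n, B \in unitmx & is_lsop (fun j => lam (row j B)).

(* lam(a) = \sum_i <a, l_i> v_i, over the rank one elements of P; the values  *)
(* of l at other elements are irrelevant.                                     *)
Definition lsop_coef n (lam : 'rV[int]_n -> face_ring) (l : P -> 'cV[int]_n) : Prop :=
  forall a, lam a = \sum_(v | rk v == 1%N) fv v *~ pairing a (l v).

(* The graph Gamma_P.  An oriented edge is a triple (s, t, w) where w is an   *)
(* (n-2)-simplex belonging to s /\ t.                                         *)

Section GraphOfPoset.
Variable n : nat.

Definition top_simplex : finType := {s : P | rk s == n}.

Definition flag_edge : finType :=
  {e : top_simplex * top_simplex * P |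
     (e.2 \in meets (val e.1.1) (val e.1.2)) && ((rk e.2).+1 == n)}.

Definition flag_src (e : flag_edge) : top_simplex := (val e).1.1.
Definition flag_wall (e : flag_edge) : P := (val e).2.

Lemma flag_rev_subproof (e : flag_edge) :
  let e' := ((val e).1.2, (val e).1.1, (val e).2) in
  (e'.2 \in meets (val e'.1.1) (val e'.1.2)) && ((rk e'.2).+1 == n).
Proof. by rewrite /= meetsC; apply: valP e. Qed.

Definition flag_rev (e : flag_edge) : flag_edge :=
  exist _ ((val e).1.2, (val e).1.1, (val e).2) (flag_rev_subproof e).

Lemma flag_revK : involutive flag_rev.
Proof. by move=> e; apply: val_inj; case: e => -[[s t] w]. Qed.

Lemma flag_loopless e : flag_src (flag_rev e) != flag_src e.
Proof.
case: e => -[[s t] w] /= ew; rewrite /flag_src /=.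
apply/eqP => ts; move: ew; rewrite {}ts => /andP[].
rewrite inE => /and3P[ws _ /forallP/(_ (val s))]; rewrite !lexx ws /= => /eqP <-.
by rewrite (eqP (valP s)) eqn_leq ltnn.
Qed.

Definition Gamma : mgraph := MGraph flag_revK flag_loopless.

(* alpha is the function on the edges of Gamma constructed from lam: at an    *)
(* edge e starting at p, <alpha(e), l_i> = delta_(i, j) for all i in I(p),    *)
(* where j is the vertex of I(p) that is not in the (n-2)-simplex of e.       *)
Definition constructed_axial (lam : 'rV[int]_n -> face_ring)
    (alpha : edge Gamma -> 'rV[int]_n) : Prop :=
  exists2 l : P -> 'cV[int]_n, lsop_coef lam l &
    forall (e : edge Gamma) (i j : P),
      rk i = 1%N -> (i <= val (src e))%O ->
      rk j = 1%N -> (j <= val (src e))%O -> ~~ (j <= flag_wall e)%O ->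
      pairing (alpha e) (l i) = (i == j)%:R.

End GraphOfPoset.
End SimplicialPosets.

Arguments Gamma {d} P n.
Arguments pseudomanifold {d} P n.

Section EquivariantCohomology.
Variables (n : nat) (G : torus_graph n).

(* f belongs to the ring H_T^*(Gamma). *)
Definition in_HT (f : {ffun vert G -> {mpoly int[n]}}) : Prop :=
  forall e : edge G, exists q, f (src e) - f (tgt e) = q * lin (axial e).

Definition tau (F : face G) (p : vert G) : {mpoly int[n]} :=
  if p \in face_verts F
  then \prod_(e in star p | e \notin face_edges F) lin (axial e) else 0.

(* [Phi] is the ring homomorphism v_F |-> tau_F identifying Z[P(Gamma)] with  *)
(* H_T^*(Gamma).  It is unique as the v_F generate Z[P(Gamma)], and it is     *)
(* injective in degree two, so that it determines the canonical lsop.         *)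
Definition is_identification
    (Phi : {rmorphism face_ring (face G) -> {ffun vert G -> {mpoly int[n]}}}) : Prop :=
  (forall F p, Phi (fv F) p = tau F p) /\ (forall x, in_HT (Phi x)).

Definition is_canonical_lsop
    (Phi : face_ring (face G) -> {ffun vert G -> {mpoly int[n]}})
    (lam : 'rV[int]_n -> face_ring (face G)) : Prop :=
  is_lsop_hom lam /\ forall t p, Phi (lam t) p = lin t.

(* Gamma_(P(Gamma)), with the functions alpha and theta, is Gamma: a vertex   *)
(* of Gamma_(P(Gamma)) is a 0-face {p} and is identified with p; an edge of   *)
(* Gamma_(P(Gamma)) is given by a 1-face with oriented edges e, rev e, and is *)
(* identified with one of these.                                              *)
Definition equals_torus_graph (alpha : edge (Gamma (face G) n) -> 'rV[int]_n)
    (theta : edge (Gamma (face G) n) -> edge (Gamma (face G) n) ->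
             edge (Gamma (face G) n)) : Prop :=
  exists (fV : vert (Gamma (face G) n) -> vert G)
         (fE : edge (Gamma (face G) n) -> edge G),
    [/\ bijective fV /\ bijective fE,
        forall x, face_verts (val x) = [set fV x],
        forall e, face_edges (flag_wall e) = [set fE e; rev (fE e)],
        forall e, src (fE e) = fV (src e) /\ fE (rev e) = rev (fE e) &
        (forall e, axial (fE e) = alpha e) /\
        (forall e e', src e' = src e -> conn (fE e) (fE e') = fE (theta e e'))].

End EquivariantCohomology.

(* Main.v *)
Require Import Defs.
From HB Require Import structures.
From mathcomp Require Import all_boot all_order all_algebra.
From mathcomp Require Import ring_quotient boolp ring.
From mathcomp Require Import mpoly.

(* (a) Condition (iii) keeps the lattice spanned by alpha(A) constant along    *)
(* the edges labelled in it, so each set A of edges at a vertex p spans one    *)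
(* face through p: the faces through p are the subsets of the star of p.       *)
(* Likewise the functional that is 0 on the edges of a facet and 1 on its      *)
(* normal edges does not depend on the vertex; these functionals are the       *)
(* coefficients of the canonical lsop.  It restricts at p to coordinates of    *)
(* Z[x_1..x_n], hence algebraic independence.  Finiteness: filtering by rank,  *)
(* v_s Z[P] is generated by v_s modulo the v_u with u > s.                     *)
(* (b) If the l_i with i in I(s) were no basis, say modulo a prime q, then a   *)
(* kernel vector x would give a map v_i |-> x_i X to F_q[X] killing the lsop,  *)
(* contradicting finiteness.  So alpha is given by dual bases, and alpha(e)    *)
(* generates the annihilator of the l_i with i in the wall of e; this gives    *)
(* (i) and (iii) at once.                                                      *)
(* (c) For the canonical lsop, lin a = sum_e <a, l_(F_e)> alpha(e) over the    *)
(* edges e at p, where F_e is the facet normal to e: the dual basis at p is    *)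
(* alpha itself, and the connection is determined by alpha.                    *)

Set Implicit Arguments.
Unset Strict Implicit.
Unset Printing Implicit Defensive.

Import Order.TTheory GRing.Theory Num.Theory.
Local Open Scope ring_scope.

(** * Simplicial posets *)

(** Everything reduces to linear algebra at one vertex. Below a fixed upper bound, an element of a
    simplicial poset is the same thing as its set of atoms ([le_atoms], [meets_below],
    [joins_below]), so the face ring can be restricted to a single simplex, where it becomes a
    polynomial ring ([face_ring_res]). In a torus graph the star of a vertex [p] plays the part of a
    maximal simplex: a face through [p] is determined by its edges at [p] ([face_eq]), and every set
    of edges at [p] occurs ([face_span]). This yields [simplex_face]. As elements of rank n and n -
    1 are the vertices and edges of the graph, [face_pseudomanifold] then expresses that an edge has
    two distinct ends and that the graph is connected.

    The bridge between lsops and axial functions is duality on simplices. [face_ring_fg] obtains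
    finiteness from dual forms, and [lsop_dual] obtains dual bases from finiteness. For a torus
    graph the axial function supplies the dual forms, through the functionals of [facet_functional];
    this gives [canonical_is_lsop]. For a pseudomanifold the dual bases define [alpha], and
    [wall_annihilator] yields the axioms that compare the two ends of an edge. In [reconstruction],
    dualizing a second time returns the original labels, and [axial_inj_mod] shows that the labels
    determine the connection. *)

Section SimplicialPosetTheory.
Variables (d : Order.disp_t) (P : finBPOrderType d).
Implicit Types s t u w i j : P.

Lemma is_simplexP k s :
  reflect (exists f : {set 'I_k} -> P,
             (forall A B, (f A <= f B)%O = (A \subset B)) /\
             (forall t, (t <= s)%O <-> exists A, f A = t))
          (is_simplex k s).
Proof.
apply: (iffP existsP) => [[f /andP[/forallP fS /forallP fs]]|[f [fS fs]]].
  exists f; split=> [A B|t]; first by rewrite (eqP (forallP (fS A) B)).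
  rewrite (eqP (fs t)); split=> [/existsP[A /eqP]|[A <-]].
    by exists A.
  by apply/existsP; exists A.
exists [ffun A => f A]; apply/andP; split.
  by apply/forallP => A; apply/forallP => B; rewrite !ffunE fS.
apply/forallP => t; apply/eqP; apply/idP/existsP => [/fs[A fA]|[A]].
  by exists A; rewrite ffunE fA.
by rewrite ffunE => /eqP At; apply/fs; exists A.
Qed.

Section SimplexChart.
Variables (k : nat) (s : P) (f : {set 'I_k} -> P).
Hypothesis fS : forall A B, (f A <= f B)%O = (A \subset B).
Hypothesis fs : forall t, (t <= s)%O <-> exists A, f A = t.

Lemma chart_inj : injective f.
Proof. by move=> A B AB; apply/eqP; rewrite eqEsubset -!fS AB lexx. Qed.

Lemma chart_card : #|[set t | (t <= s)%O]| = (2 ^ k)%N.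
Proof.
have -> : [set t | (t <= s)%O] = f @: setT.
  apply/setP => t; rewrite !inE; apply/idP/imsetP => [/fs[A <-]|[A _ ->]].
    by exists A; rewrite ?inE.
  by apply/fs; exists A.
rewrite card_imset ?cardsT; last exact: chart_inj.
by rewrite -cardsT -powersetT card_powerset cardsT card_ord.
Qed.

Lemma chart_sub (A : {set 'I_k}) : is_simplex #|A| (f A).
Proof.
apply/is_simplexP; exists (fun B : {set 'I_#|A|} => f (enum_val @: B)); split.
  move=> B C; rewrite fS; apply/idP/idP => [/subsetP BC|]; last exact: imsetS.
  apply/subsetP => x xB; have /imsetP[y yC /enum_val_inj->//] :
    enum_val x \in (enum_val @: C) by apply: BC; apply: imset_f.
move=> t; split=> [tA|[B <-]]; last first.
  by rewrite fS; apply/subsetP => _ /imsetP[x _ ->]; apply: enum_valP.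
have /fs[B Bt] : (t <= s)%O.
  by apply: le_trans tA _; apply/fs; exists A.
move: tA; rewrite -Bt fS => /subsetP BA.
exists [set x | enum_val x \in B]; congr f; apply/setP => x.
apply/imsetP/idP => [[y]|xB]; first by rewrite inE => ? ->.
by exists (enum_rank_in (BA _ xB) x); rewrite ?inE enum_rankK_in ?BA.
Qed.

End SimplexChart.

(** There are 2^k elements below [s], which determines [k] and also keeps it within the range of the
    maximum defining [rk]. *)
Lemma rk_simplex k s : is_simplex k s -> rk s = k.
Proof.
move=> ks; have card_lt (m : nat) : is_simplex m s -> #|[set t | (t <= s)%O]| = (2 ^ m)%N.
  by case/is_simplexP => f [fS fs]; exact: chart_card fS fs.
have kP : (k < #|P|.+1)%N.
  rewrite ltnS (leq_trans (ltnW (ltn_expl k (ltnSn 1)))) //.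
  by rewrite -(card_lt _ ks) max_card.
apply/eqP; rewrite eqn_leq; apply/andP; split.
  apply/bigmax_leqP => m /card_lt; rewrite (card_lt _ ks) => /eqP.
  by rewrite eqn_exp2l // => /eqP->.
exact: (@leq_bigmax_cond _ (fun m : 'I__ => is_simplex m s) (fun m => val m) (Ordinal kP)).
Qed.

(** * Elements of a simplicial poset as sets of atoms *)

Definition atoms s : {set P} := [set i | (rk i == 1%N) && (i <= s)%O].

Lemma atomsP i s : reflect (rk i = 1%N /\ (i <= s)%O) (i \in atoms s).
Proof. by rewrite inE; apply: (iffP andP) => -[/eqP]. Qed.

Hypothesis sP : simplicial P.

Lemma simplex_rk s : is_simplex (rk s) s.
Proof. by have [k ks] := sP s; rewrite (rk_simplex ks). Qed.

(** The chart of [s] by subsets of an index set, rewritten in terms of its actual atoms: [f] inverts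
    [atoms] below [s]. Later arguments use this instead of charts. *)
Lemma atoms_chart s : exists f : {set P} -> P,
  [/\ forall A : {set P}, A \subset atoms s -> (f A <= s)%O /\ atoms (f A) = A,
      forall t, (t <= s)%O -> f (atoms t) = t & #|atoms s| = rk s].
Proof.
have /is_simplexP[f [fS fs]] := simplex_rk s.
have rkf (A : {set 'I_(rk s)}) : rk (f A) = #|A| by apply: rk_simplex; apply: (chart_sub fS fs).
have at_f (A : {set 'I_(rk s)}) : atoms (f A) = [set f [set a] | a in A].
  apply/setP => i; apply/atomsP/imsetP => [[i1 iA]|[a aA ->]]; last first.
    by rewrite rkf cards1 fS sub1set.
  have [B Bi] : exists B, f B = i.
    by apply/fs; apply: le_trans iA _; apply/fs; exists A.
  move: i1 iA; rewrite -Bi rkf => /eqP/cards1P[a ->]; rewrite fS sub1set.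
  by exists a.
have f1_inj : injective (fun a => f [set a]).
  by move=> a b /(chart_inj fS)/set1_inj.
have [T Ts] : exists A, f A = s by apply/fs.
have TT : T = setT.
  apply/eqP; rewrite eqEsubset subsetT /= -fS Ts; apply/fs; by exists setT.
exists (fun A : {set P} => f [set a | f [set a] \in A]); split.
- move=> A /subsetP As; split; first by apply/fs; eexists.
  rewrite at_f; apply/setP => i; apply/imsetP/idP => [[a]|iA].
    by rewrite inE => aA ->.
  have := As _ iA; rewrite -[X in atoms X]Ts at_f => /imsetP[a _ ia].
  by exists a; rewrite // inE -ia.
- move=> t /fs[A <-]; congr f; apply/setP => a; rewrite inE at_f.
  by rewrite mem_imset.
- by rewrite -[X in atoms X]Ts at_f TT card_imset // cardsT card_ord.
Qed.

Lemma card_atoms s : #|atoms s| = rk s.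
Proof. by have [f []] := atoms_chart s. Qed.

Lemma atoms_le s t : (s <= t)%O -> atoms s \subset atoms t.
Proof.
move=> st; apply/subsetP => i /atomsP[i1 is_]; apply/atomsP; split=> //.
exact: le_trans is_ st.
Qed.

Lemma le_atoms u s t :
  (s <= u)%O -> (t <= u)%O -> (s <= t)%O = (atoms s \subset atoms t).
Proof.
move=> su tu; apply/idP/idP => [|st]; first exact: atoms_le.
have [f [fA fK _]] := atoms_chart t.
have [ft atf] := fA _ st; have [g [_ gK _]] := atoms_chart u.
by rewrite -(gK _ su) -atf gK // (le_trans ft).
Qed.

Lemma atoms_inj u s t :
  (s <= u)%O -> (t <= u)%O -> atoms s = atoms t -> s = t.
Proof.
move=> su tu st; apply/eqP.
by rewrite eq_le (le_atoms su tu) (le_atoms tu su) st subxx.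
Qed.

Lemma atoms_ex s (A : {set P}) :
  A \subset atoms s -> exists2 t, (t <= s)%O & atoms t = A.
Proof. by move=> As; have [f [fA _ _]] := atoms_chart s; exists (f A); have [] := fA _ As. Qed.

Lemma atoms_rk1 i : rk i = 1%N -> atoms i = [set i].
Proof.
move=> i1; have /eqP/cards1P[j ij] : #|atoms i| = 1%N by rewrite card_atoms.
have : i \in atoms i by apply/atomsP.
by rewrite ij inE => /eqP->.
Qed.

Lemma atoms0 : atoms \bot%O = set0.
Proof.
have [t tb t0] := atoms_ex (sub0set (atoms (\bot%O : P))).
by move: tb; rewrite lex0 => /eqP <-.
Qed.

Lemma rk_eq0 s : (rk s == 0%N) = (s == \bot%O).
Proof.
apply/idP/eqP => [|->]; last by rewrite -card_atoms atoms0 cards0.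
rewrite -card_atoms cards_eq0 => /eqP s0.
by apply: (@atoms_inj s); rewrite ?atoms0.
Qed.

Lemma le_rk_eq s t : (s <= t)%O -> (rk t <= rk s)%N -> s = t.
Proof.
move=> st ts; apply: (@atoms_inj t) => //; apply/eqP.
by rewrite eqEcard atoms_le // !card_atoms.
Qed.

Lemma rk_lt s t : (s < t)%O -> (rk s < rk t)%N.
Proof.
move=> st; rewrite ltnNge; apply/negP => /(le_rk_eq (ltW st)) E.
by rewrite E ltxx in st.
Qed.

Lemma meets_below u s t : (s <= u)%O -> (t <= u)%O ->
  exists w, [/\ (w <= u)%O, atoms w = atoms s :&: atoms t & meets s t = [set w]].
Proof.
move=> su tu.
have [w wu ws] : exists2 w, (w <= u)%O & atoms w = atoms s :&: atoms t.
  by apply: atoms_ex; rewrite subIset ?atoms_le.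
have wst : (w <= s)%O && (w <= t)%O.
  by rewrite (le_atoms wu su) (le_atoms wu tu) ws subsetIl subsetIr.
have wM v : (v <= s)%O -> (v <= t)%O -> (v <= w)%O.
  move=> vs vt; rewrite (le_atoms (le_trans vs su) wu) ws subsetI.
  by rewrite !atoms_le.
exists w; split=> //; apply/setP => v; rewrite !inE; apply/idP/eqP => [|->].
  case/and3P => vs vt /forallP/(_ w); rewrite andbA wst wM //=.
  by move/eqP.
rewrite andbA wst; apply/forallP => v'; apply/implyP => /and3P[vs vt wv].
by rewrite eq_le wv wM.
Qed.

(** In contrast to meets, uniqueness holds only below [u]: [s] and [t] may have further minimal
    upper bounds elsewhere. *)
Lemma joins_below u s t : (s <= u)%O -> (t <= u)%O ->
  exists w, [/\ (w <= u)%O, atoms w = atoms s :|: atoms t &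
                [set v in joins s t | (v <= u)%O] = [set w]].
Proof.
move=> su tu.
have [w wu ws] : exists2 w, (w <= u)%O & atoms w = atoms s :|: atoms t.
  by apply: atoms_ex; rewrite subUset !atoms_le.
have stw : (s <= w)%O && (t <= w)%O.
  by rewrite (le_atoms su wu) (le_atoms tu wu) ws subsetUl subsetUr.
have wM v : (v <= u)%O -> (s <= v)%O -> (t <= v)%O -> (w <= v)%O.
  move=> vu sv tv; rewrite (le_atoms wu vu) ws subUset.
  by rewrite !atoms_le.
exists w; split=> //; apply/setP => v; rewrite !inE; apply/idP/eqP => [|->].
  case/andP => /and3P[sv tv /forallP vmin] vu; move: (vmin w).
  by rewrite andbA stw wM //= => /eqP.
rewrite wu andbT andbA stw; apply/forallP => v'; apply/implyP => /and3P[sv tv vw].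
by rewrite eq_le vw wM // (le_trans vw).
Qed.

End SimplicialPosetTheory.

(** * The face ring *)

Section FaceRingTheory.
Variables (d : Order.disp_t) (P : finBPOrderType d).
Implicit Types s t u w i j : P.

Fact face_class_additive : zmod_morphism (@face_class d P).
Proof. exact: (rmorphB (\pi_({ideal_quot (face_idealr P)})%qT)). Qed.
Fact face_class_multiplicative : monoid_morphism (@face_class d P).
Proof.
split; first exact: (rmorph1 (\pi_({ideal_quot (face_idealr P)})%qT)).
exact: (rmorphM (\pi_({ideal_quot (face_idealr P)})%qT)).
Qed.
HB.instance Definition _ := GRing.isZmodMorphism.Build _ _ (@face_class d P)
  face_class_additive.
HB.instance Definition _ := GRing.isMonoidMorphism.Build _ _ (@face_class d P)
  face_class_multiplicative.

Lemma face_classK (x : face_ring P) : face_class (repr x) = x.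
Proof. exact: reprK. Qed.

Lemma face_class_eq (p q : {mpoly int[nvar P]}) :
  face_class p = face_class q -> in_face_ideal (p - q).
Proof.
move=> pq; have : (p - q) \in face_idealr P.
  by rewrite Quotient.idealrBE; apply/eqP.
by move/asboolP.
Qed.

Lemma fv_bot : fv (\bot%O : P) = 1.
Proof. by rewrite /fv var_bot rmorph1. Qed.

Lemma face_rel_in s t : in_face_ideal (face_rel s t).
Proof.
exists (fun s' t' => ((s' == s) && (t' == t))%:R).
rewrite (bigD1 s) //= (bigD1 t) //= !eqxx mul1r big1 ?addr0 => [|t' /negPf->].
  rewrite big1 ?addr0 // => s' /negPf->.
  by rewrite big1 // => t' _; rewrite mul0r.
by rewrite andbF mul0r.
Qed.

Lemma fv_rel s t :
  fv s * fv t = (\sum_(w in meets s t) fv w) * (\sum_(u in joins s t) fv u).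
Proof.
rewrite /fv -!rmorph_sum -!rmorphM; apply/eqP.
rewrite /face_class -Quotient.idealrBE; apply/asboolP; exact: face_rel_in.
Qed.

Lemma var_gen (i : 'I_(nvar P)) : 'X_i = var (val (enum_val i : gen P)).
Proof.
rewrite /var; case: insubP => [x _ vx|]; last by rewrite (valP (enum_val i : gen P)).
by rewrite (val_inj vx) enum_valK.
Qed.

(** The classes [fv s] generate the face ring as a ring, and 1 is among them as [fv \bot]. *)
Lemma face_ring_ind (Q : face_ring P -> Prop) :
  (forall x y, Q x -> Q y -> Q (x - y)) -> (forall x y, Q x -> Q y -> Q (x * y)) ->
  (forall s, Q (fv s)) -> forall x, Q x.
Proof.
move=> QB QM Qv x; have Q1 : Q 1 by rewrite -fv_bot.
have Q0 : Q 0 by rewrite -(subrr 1); apply: (QB).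
have QN y : Q y -> Q (- y) by rewrite -sub0r; apply: (QB).
have QD y z : Q y -> Q z -> Q (y + z) by move=> Qy Qz; rewrite -[z]opprK; apply/QB/QN.
have Qint (c : int) : Q c%:~R.
  have Qnat k : Q k%:R by elim: k => // k IH; rewrite mulrS; apply: (QD).
  by case: c => k; rewrite ?NegzE ?mulrNz; [|apply: (QN)]; apply: (Qnat).
rewrite -(face_classK x); elim/mpolyind: (repr x) => [|c m p _ _ Qp].
  by rewrite rmorph0.
rewrite rmorphD; apply: (QD) => //; rewrite -mul_mpolyC rmorphM; apply: (QM).
  by rewrite -[c]intz rmorph_int /= rmorph_int.
rewrite mpolyXE_id rmorph_prod; apply: (big_ind Q Q1 QM) => i _.
rewrite rmorphXn /= var_gen; elim: (m i) => [|k IH]; rewrite ?expr0 ?exprS //.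
by apply: (QM) => //; apply: (Qv).
Qed.

(** Universal property of the face ring: evaluation at [f] kills the face relations, so it does not
    depend on the representative. *)
Lemma face_ring_lift (R : comNzRingType) (f : P -> R) : f \bot%O = 1 ->
  (forall s t, f s * f t = (\sum_(w in meets s t) f w) * (\sum_(u in joins s t) f u)) ->
  exists Psi : {rmorphism face_ring P -> R}, forall s, Psi (fv s) = f s.
Proof.
move=> f1 fM; pose h (i : 'I_(nvar P)) := f (val (enum_val i : gen P)).
pose ev : {rmorphism {mpoly int[nvar P]} -> R} := mmap intr h.
have evv s : ev (var s) = f s.
  rewrite /var; case: insubP => [x _ <-|].
    by rewrite /ev /= mmapX mmap1U /h enum_rankK.
  by rewrite negbK => /eqP->; rewrite rmorph1.
have ev_rel p : in_face_ideal p -> ev p = 0.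
  case=> c ->; rewrite rmorph_sum big1 // => s _; rewrite rmorph_sum big1 // => t _.
  rewrite rmorphM rmorphB !rmorphM !rmorph_sum !evv.
  rewrite (eq_bigr f) => [|w _]; last exact: evv.
  rewrite [X in _ - _ * X](eq_bigr f) => [|w _]; last exact: evv.
  by rewrite fM subrr mulr0.
pose g (x : face_ring P) := ev (repr x).
have gE p : g (face_class p) = ev p.
  apply/eqP; rewrite -subr_eq0 /g -rmorphB; apply/eqP/ev_rel/face_class_eq.
  exact: face_classK.
have gB : zmod_morphism g.
  by move=> x y; rewrite -(face_classK x) -(face_classK y) -rmorphB !gE rmorphB.
have gM : monoid_morphism g.
  split; first by rewrite -(rmorph1 (@face_class d P)) gE rmorph1.
  by move=> x y; rewrite -(face_classK x) -(face_classK y) -rmorphM !gE rmorphM.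
pose Psi : {rmorphism face_ring P -> R} :=
  HB.pack g (GRing.isZmodMorphism.Build _ _ g gB) (GRing.isMonoidMorphism.Build _ _ g gM).
by exists Psi => s; rewrite -[LHS]/(g _) gE evv.
Qed.

Hypothesis sP : simplicial P.

(** Restriction to the simplex [s], followed by substitution of [x] for its vertices. If [t] and [u]
    are below [s], only one join survives, and the face relation says that the products over two
    sets multiply to those over their intersection and union. Otherwise both sides vanish. *)
Lemma face_ring_res (R : comNzRingType) s (x : P -> R) :
  exists Psi : {rmorphism face_ring P -> R},
    forall t, Psi (fv t) = if (t <= s)%O then \prod_(i in atoms t) x i else 0.
Proof.
apply: face_ring_lift => [|t u]; first by rewrite le0x (atoms0 sP) big_set0.
have [ts|ts] := boolP (t <= s)%O; last first.
  rewrite mul0r [X in _ * X]big1 ?mulr0 // => w; rewrite inE => /and3P[tw _ _].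
  by case: ifP => // ws; case/negP: ts; apply: le_trans ws.
have [us|us] := boolP (u <= s)%O; last first.
  rewrite mulr0 [X in _ * X]big1 ?mulr0 // => w; rewrite inE => /and3P[_ uw _].
  by case: ifP => // ws; case/negP: us; apply: le_trans ws.
have [m [ms ma ->]] := meets_below sP ts us; rewrite big_set1 ms ma.
have [w [ws wa wj]] := joins_below sP ts us.
rewrite -big_mkcondr /=.
rewrite [X in _ = _ * X](eq_bigl (fun v => v \in [set w])) => [|v]; last by rewrite -wj inE.
rewrite big_set1 wa [X in _ = _ * X](big_setID (atoms t)) /= setUK setDUl setDv set0U.
rewrite [X in _ * X = _](big_setID (atoms t)) /= (setIC (atoms u)).
by rewrite mulrCA.
Qed.

(** All variables have positive rank, so a monomial of weighted degree two is a single variable of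
    rank one. *)
Lemma homogeneous2 (x : face_ring P) : homogeneous 2 x ->
  exists c : P -> int, x = \sum_(v | rk v == 1%N) fv v *~ c v.
Proof.
case=> p -> hp; rewrite (mpolyE p) rmorph_sum big_seq.
pose L (y : face_ring P) := exists c : P -> int, y = \sum_(v | rk v == 1%N) fv v *~ c v.
apply: (big_ind L) => [|_ _ [c ->] [c' ->]|m /hp wm].
- by exists (fun=> 0); rewrite big1.
- exists (fun v => c v + c' v); rewrite -big_split; apply: eq_bigr => v _.
  by rewrite mulrzDr.
have rk_gt0 (i : 'I_(nvar P)) : (0 < rk (val (enum_val i : gen P)))%N.
  by rewrite lt0n (rk_eq0 sP) (valP (enum_val i : gen P)).
have wm1 : (\sum_(i < nvar P) m i * rk (val (enum_val i : gen P)) = 1)%N.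
  apply/eqP; rewrite -(eqn_pmul2l (m := 2)) //; apply/eqP.
  by rewrite muln1 -[RHS]wm /wdeg big_distrr /=; apply: eq_bigr => i _; rewrite mulnCA.
have : mdeg m == 1%N.
  rewrite eqn_leq; apply/andP; split.
    by rewrite -wm1 mdegE; apply: leq_sum => i _; rewrite leq_pmulr.
  rewrite lt0n mdeg_eq0; apply/eqP => m0; move: wm1; rewrite m0 big1 // => i _.
  by rewrite mnm0E mul0n.
rewrite mdeg_eq1 => /existsP[i /eqP mi].
have i1 : rk (val (enum_val i : gen P)) = 1%N.
  rewrite -wm1 (bigD1 i) //= mi mnm1E eqxx mul1n big1 ?addn0 // => j ji.
  by rewrite mnm1E eq_sym (negPf ji) mul0n.
exists (fun v => if v == val (enum_val i : gen P) then p@_m else 0).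
rewrite (bigD1 (val (enum_val i : gen P))) ?i1 //= eqxx big1 ?addr0.
  rewrite -mul_mpolyC rmorphM /= -[p@_m in LHS]intz rmorph_int /= rmorph_int mulrzl.
  by rewrite mi var_gen.
by move=> j /andP[_ /negPf->].
Qed.

Lemma face_ring_coef (c : P -> int) :
  \sum_(v | rk v == 1%N) fv v *~ c v = 0 -> forall v, rk v = 1%N -> c v = 0.
Proof.
move=> c0 v v1; have [Psi PsiE] := face_ring_res v (fun i => (i == v)%:R : int).
move/(congr1 Psi): c0; rewrite rmorph0 rmorph_sum (bigD1 v) ?v1 //= big1 ?addr0.
  by rewrite rmorphMz PsiE lexx (atoms_rk1 sP) // big_set1 eqxx intz.
move=> w /andP[/eqP w1 wv]; rewrite rmorphMz PsiE (atoms_rk1 sP) // big_set1.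
by rewrite (negPf wv) if_same mul0rz.
Qed.

(* Filtering by rank, [v_s * Z[P]] is generated by [v_s] over the subring [A]  *)
(* modulo the ideal of the [v_u] with [u > s], because the linear forms of [A] *)
(* hit every [v_i v_s] with [i] a vertex of [s].                               *)
Lemma face_ring_fg n (A : {rmorphism {mpoly int[n]} -> face_ring P}) :
  (forall s i, i \in atoms s -> exists q, exists2 c : P -> int,
     A q = \sum_(v | rk v == 1%N) fv v *~ c v &
     forall j, j \in atoms s -> c j = (j == i)%:R) ->
  forall x, exists q : P -> {mpoly int[n]}, x = \sum_s A (q s) * fv s.
Proof.
move=> dual; pose S (x : face_ring P) := exists q : P -> {mpoly int[n]}, x = \sum_s A (q s) * fv s.
have SD x y : S x -> S y -> S (x + y).
  case=> [q ->] [q' ->]; exists (fun s => q s + q' s); rewrite -big_split.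
  by apply: eq_bigr => s _; rewrite rmorphD mulrDl.
have SA c s : S (A c * fv s).
  exists (fun t => if t == s then c else 0); rewrite (bigD1 s) //= eqxx big1 ?addr0 //.
  by move=> t /negPf->; rewrite rmorph0 mul0r.
have S0 : S 0 by exists (fun=> 0); rewrite big1 // => s _; rewrite rmorph0 mul0r.
(* Induction on the number of elements above [s]; the case of the bottom element is the claim. *)
suff vS k s : (#|[set u | (s < u)%O]| < k)%N -> forall y, S (fv s * y).
  by move=> x; have := vS _ \bot%O (ltnSn _) x; rewrite fv_bot mul1r.
elim: k s => // k IH s sk.
(* The ideal generated by the [fv u] with [u > s]; it lies in [S] by induction. *)
pose N x := exists g : P -> face_ring P, x = \sum_(u | (s < u)%O) fv u * g u.
have NS x : N x -> S x.
  case=> g ->; apply: (big_ind S) => // u su; apply: (IH).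
  rewrite -ltnS; apply: leq_trans sk; rewrite ltnS.
  rewrite [X in (_ <= X)%N](cardsD1 u) inE su add1n ltnS; apply: subset_leq_card.
  apply/subsetP => v; rewrite !inE => uv; rewrite (lt_trans su uv) andbT.
  by rewrite eq_sym; case: eqP uv => // ->; rewrite ltxx.
have ND x y : N x -> N y -> N (x + y).
  case=> [g ->] [g' ->]; exists (fun u => g u + g' u); rewrite -big_split.
  by apply: eq_bigr => u _; rewrite mulrDr.
have NM x y : N x -> N (x * y).
  case=> [g ->]; exists (fun u => g u * y); rewrite big_distrl.
  by apply: eq_bigr => u _; rewrite mulrA.
have N0 : N 0 by exists (fun=> 0); rewrite big1 // => u _; rewrite mulr0.
have NN x : N x -> N (- x) by rewrite -mulrN1; apply: (NM).
have Nv t : ~~ (t <= s)%O -> N (fv s * fv t).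
  move=> ts; rewrite fv_rel mulrC; apply: (NM); apply: (big_ind N) => // u.
  rewrite inE => /and3P[su tu _]; exists (fun v => (v == u)%:R).
  rewrite (bigD1 u) /=; last by rewrite lt_neqAle su andbT; apply: contraNneq ts => ->.
  by rewrite eqxx mulr1 big1 ?addr0 // => v /andP[_ /negPf->]; rewrite mulr0.
(* Modulo [N], such a [y] acts on [fv s] as an element of the image of [A]. These [y] form a
   subring, so only the generators have to be treated. *)
pose Q y := exists c, N (fv s * y - A c * fv s).
have QB x y : Q x -> Q y -> Q (x - y).
  case=> [c Nc] [c' Nc']; exists (c - c'); rewrite rmorphB mulrBr mulrBl.
  by rewrite opprD addrACA -opprD; apply/ND/NN.
have QM x y : Q x -> Q y -> Q (x * y).
  case=> [c Nc] [c' Nc']; exists (c * c').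
  have -> : fv s * (x * y) - A (c * c') * fv s =
            (fv s * x - A c * fv s) * y + (fv s * y - A c' * fv s) * A c.
    by rewrite rmorphM; ring.
  by apply: (ND); apply: (NM).
have Q0 : Q 0 by exists 0; rewrite rmorph0 mulr0 mul0r subr0.
have QN x : Q x -> Q (- x) by rewrite -sub0r; apply: (QB).
have QD x y : Q x -> Q y -> Q (x + y) by move=> Qx Qy; rewrite -[y]opprK; apply/QB/QN.
have Qnle t : ~~ (t <= s)%O -> Q (fv t).
  by move=> ts; exists 0; rewrite rmorph0 mul0r subr0; apply: Nv.
have Qatom i : i \in atoms s -> Q (fv i).
  move=> is_; have [q [c Aq cE]] := dual s i is_; exists q.
  have /atomsP[i1 ils] := is_.
  rewrite Aq (bigD1 i) ?i1 //= (cE i) // eqxx mulr1z mulrDl [fv i * _]mulrC opprD addrA.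
  rewrite subrr sub0r; apply/NN; rewrite big_distrl /=; apply: (big_ind N) => // j /andP[j1 ji].
  have [js|js] := boolP (j <= s)%O.
    by rewrite (cE j) ?(negPf ji) ?mulr0z ?mul0r // inE j1.
  by rewrite mulrC mulrzAr -mulrzl mulrC; apply/NM/Nv.
have Qv t : Q (fv t).
  have [ts|/Qnle//] := boolP (t <= s)%O.
  have [m] := ubnP #|atoms t|; elim: m t ts => // m IHm t ts.
  rewrite ltnS => tm; have [t0|[i it]] := set_0Vmem (atoms t).
    have -> : t = \bot%O by apply/eqP; rewrite -(rk_eq0 sP) -(card_atoms sP) t0 cards0.
    by exists 1; rewrite rmorph1 fv_bot mulr1 mul1r subrr.
  have /atomsP[i1 ilt] := it; have ils := le_trans ilt ts.
  have [t' t't at'] : exists2 t', (t' <= t)%O & atoms t' = atoms t :\ i.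
    by apply: (atoms_ex sP); rewrite subsetDl.
  have t's := le_trans t't ts.
  have [w [_ aw wM]] := meets_below sP ils t's.
  have [u [us au uJ]] := joins_below sP ils t's.
  have ut : u = t.
    by apply: (atoms_inj sP us ts); rewrite au at' (atoms_rk1 sP) // setD1K.
  have w0 : w = \bot%O.
    apply/eqP; rewrite -(rk_eq0 sP) -(card_atoms sP) aw at' (atoms_rk1 sP) //.
    apply/eqP/eqP; rewrite cards_eq0; apply/eqP/setP => j; rewrite !inE.
    by case: eqP.
  have /setP/(_ t) := uJ; rewrite !inE ut eqxx => /andP[tJ _].
  (* As [i] and [t'] have no common atom, their product is the sum of their joins, and [t] is the
     only join below [s]; the others are covered by [Qnle]. *)
  have := fv_rel i t'; rewrite wM w0 big_set1 fv_bot mul1r (bigD1 t) /= ?inE // => /eqP.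
  rewrite -subr_eq => /eqP <-; apply: (QB).
    apply: (QM); first by apply: (Qatom); rewrite inE i1.
    apply: IHm => //; apply: leq_trans tm; rewrite at' [X in (_ < X)%N](cardsD1 i) it.
    by rewrite add1n.
  apply: (big_ind Q) => // v; rewrite -[X in X && _]/(v \in joins i t') => /andP[vJ vt].
  apply: (Qnle); apply: contraNN vt => vs; rewrite -ut.
  by have /setP/(_ v) := uJ; rewrite in_set1 => <-; rewrite inE vJ.
move=> y; have [c /NS Nc] : Q y by apply: face_ring_ind.
by rewrite -(subrK (A c * fv s) (fv s * y)); apply: (SD).
Qed.

End FaceRingTheory.

(** * Linear systems of parameters *)

Lemma pairingD n (a b : 'rV[int]_n) l : pairing (a + b) l = pairing a l + pairing b l.
Proof. by rewrite /pairing mulmxDl mxE. Qed.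

Lemma pairingB n (a b : 'rV[int]_n) l : pairing (a - b) l = pairing a l - pairing b l.
Proof. by rewrite /pairing mulmxBl !mxE. Qed.

Lemma pairingZ n c (a : 'rV[int]_n) l : pairing (c *: a) l = c * pairing a l.
Proof. by rewrite /pairing -scalemxAl mxE. Qed.

Lemma pairing_sum n (I : Type) (r : seq I) (Q : pred I) (a : I -> 'rV[int]_n) l :
  pairing (\sum_(i <- r | Q i) a i) l = \sum_(i <- r | Q i) pairing (a i) l.
Proof. by rewrite /pairing mulmx_suml summxE. Qed.

Section LsopTheory.
Variables (d : Order.disp_t) (P : finBPOrderType d).
Implicit Types s t u w i : P.
Hypothesis sP : simplicial P.
Variables (n : nat) (lam : {additive 'rV[int]_n -> face_ring P}).
Hypothesis lamP : is_lsop_hom lam.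

Lemma additive_row (V : zmodType) (f : {additive 'rV[int]_n -> V}) m (z : 'rV[int]_m)
    (B : 'M[int]_(m, n)) : f (z *m B) = \sum_(j < m) f (row j B) *~ z 0 j.
Proof.
rewrite mulmx_sum_row raddf_sum; apply: eq_bigr => j _.
by rewrite -[z 0 j in LHS]intz scaler_int raddfMz.
Qed.

Lemma lsop_hom_coef : exists l, lsop_coef lam l.
Proof.
case: lamP => B Bu [hom _ _].
have /choice[c cE] j := homogeneous2 sP (hom j).
exists (fun v => invmx B *m \col_j c j v) => a.
rewrite -[a in LHS](mulmxKV Bu) additive_row.
under eq_bigr do rewrite cE mulrz_suml.
rewrite exchange_big; apply: eq_bigr => v _ /=.
rewrite /pairing mulmxA mxE mulrz_sumr; apply: eq_bigr => j _.
by rewrite !mxE -mulrzA mulrC.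
Qed.

Variable l : P -> 'cV[int]_n.
Hypothesis lamE : lsop_coef lam l.

Section TopSimplex.
Variables (s : P) (sn : rk s = n).

Let E : n = #|atoms s|. Proof. by rewrite card_atoms. Qed.
Let idx (k : 'I_n) : P := enum_val (cast_ord E k).
Let coefs : 'M[int]_n := \matrix_(j, k) l (idx k) j 0.

Let idx_inj : injective idx.
Proof. by move=> k k' /enum_val_inj/cast_ord_inj. Qed.

Let idx_atom k : idx k \in atoms s.
Proof. exact: enum_valP. Qed.

Let idx_surj i : i \in atoms s -> exists k, i = idx k.
Proof.
move=> is_; exists (cast_ord (esym E) (enum_rank_in is_ i)).
by rewrite /idx cast_ordKV enum_rankK_in.
Qed.

Let pairing_idx a k : pairing a (l (idx k)) = (a *m coefs) 0 k.
Proof. by rewrite /pairing !mxE; apply: eq_bigr => j _; rewrite !mxE. Qed.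

(* If a prime p divides the determinant, a kernel vector x mod p gives a      *)
(* homomorphism v_i |-> x_i X onto a subring of F_p[X] that kills the lsop,   *)
(* so that Z[P] is not finite over it: the degrees are unbounded.             *)
Let coefs_unit : coefs \in unitmx.
Proof.
rewrite unitmxE; apply: contrapT => /negP detN.
have [p p_pr detp] : exists2 p, prime p & (\det coefs)%:~R = 0 :> 'F_p.
  have dvdp p : prime p -> (p %| `|\det coefs|)%N -> (\det coefs)%:~R = 0 :> 'F_p.
    by move=> p_pr pd; apply/eqP; rewrite -(dvdz_pcharf (pchar_Fp p_pr)).
  (* If the determinant is zero, every prime divides it, and 2 is an arbitrary choice. *)
  have [m0|mn0] := eqVneq `|\det coefs|%N 0%N.
    by exists 2%N => //; apply: dvdp; rewrite // m0 dvdn0.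
  have m1 : (1 < `|\det coefs|)%N.
    rewrite ltn_neqAle eq_sym lt0n mn0 andbT; apply/eqP => m1; case/negP: detN.
    by case: (\det coefs) m1 => -[|[|m]].
  by exists (pdiv `|\det coefs|); [apply: pdiv_prime|apply: dvdp; rewrite ?pdiv_prime ?pdiv_dvd].
have /det0P[x xn0 xM] : \det (map_mx (intr : int -> 'F_p) coefs)^T == 0.
  by apply/eqP; rewrite det_tr det_map_mx; exact: detp.
(* The filtered sum extends k |-> x_k X from the vertices [idx k] of [s] to a function on [P]. *)
have [Psi PsiE] := face_ring_res sP s
  (fun i => \sum_(k < n | idx k == i) x 0 k *: 'X : {poly 'F_p}).
have Psi_idx k : Psi (fv (idx k)) = x 0 k *: 'X.
  have /atomsP[i1 ils] := idx_atom k.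
  rewrite PsiE ils (atoms_rk1 sP) // big_set1 (bigD1 k) //= big1 ?addr0 //.
  by move=> k' /andP[/eqP/idx_inj ->]; rewrite eqxx.
have Psi_lam a : Psi (lam a) = 0.
  rewrite lamE rmorph_sum (bigID (fun v => (v <= s)%O)) /= [X in _ + X]big1 ?addr0; last first.
    by move=> v /andP[_ /negPf vs]; rewrite rmorphMz PsiE vs mul0rz.
  rewrite (eq_bigl (fun v => v \in idx @: setT)) => [|v]; last first.
    apply/andP/imsetP => [[/eqP v1 vs]|[k _ ->]].
      by have /idx_surj[k ->] : v \in atoms s by [apply/atomsP]; exists k.
    by have /atomsP[-> ->] := idx_atom k.
  rewrite big_imset /=; last by move=> k k' _ _; apply: idx_inj.
  under eq_bigr do rewrite rmorphMz Psi_idx pairing_idx -mulrzl -[_ *: _]mul_polyC mulrA.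
  rewrite -big_distrl /= (eq_bigl xpredT) => [|k]; last by rewrite inE.
  suff -> : \sum_k ((a *m coefs) 0 k)%:~R * (x 0 k)%:P = 0 :> {poly 'F_p} by rewrite mul0r.
  have : (map_mx intr a *m (x *m (map_mx intr coefs)^T)^T) 0 0 = 0 :> 'F_p.
    by rewrite xM trmx0 mulmx0 mxE.
  rewrite trmx_mul trmxK mulmxA -map_mxM mxE => /(congr1 polyC).
  rewrite polyC0 raddf_sum => S0; rewrite -[RHS]S0; apply: eq_bigr => k _.
  rewrite !mxE; apply: esym; apply: (etrans (polyCM _ _)); congr (_ * _).
  exact: (rmorph_int polyC).
have [B Bu [_ _ [K [g gP]]]] := lamP.
set th := fun j : 'I_n => lam (row j B) in gP.
have Psi_const q : exists c, Psi (eval_at th q) = c%:P.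
  pose C (y : {poly 'F_p}) := exists c, y = c%:P.
  elim/mpolyind: q => [|c m q _ _ [c' IH]].
    by exists 0; rewrite /eval_at !rmorph0.
  have [c2 c2E] : exists c2, Psi (mmap intr th 'X_[m]) = c2%:P.
    rewrite mmapX /mmap1 rmorph_prod; apply: (big_ind C) => [|_ _ [y ->] [z ->]|j _].
    - by exists 1.
    - by exists (y * z); rewrite polyCM.
    - by exists (0 ^+ m j); rewrite rmorphXn /= (Psi_lam) polyC_exp polyC0.
  exists (c%:~R * c2 + c'); rewrite polyCD -IH /eval_at !rmorphD; congr (_ + _).
  by rewrite /= mmapZ rmorphM /= c2E rmorph_int polyCM rmorph_int.
pose N := \max_(k < K) size (Psi (g k)).
have size_Psi y : (size (Psi y) <= N)%N.
  have [q ->] := gP y; rewrite rmorph_sum; apply: leq_trans (size_sum _ _ _) _.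
  apply/bigmax_leqP => k _; have [c qE] := Psi_const (q k).
  rewrite rmorphM /= qE mul_polyC; apply: leq_trans (size_scale_leq _ _) _.
  exact: (leq_bigmax k).
have [k xk] : exists k, x 0 k != 0.
  apply: contrapT => xk; case/negP: xn0; apply/eqP/rowP => k; rewrite mxE.
  by apply/eqP; apply: contrapT => xk0; apply: xk; exists k; apply/negP.
(* The image is x_k^N X^N with nonzero coefficient; its size N + 1 exceeds the bound [N]. *)
have := size_Psi (fv (idx k) ^+ N); rewrite rmorphXn /= Psi_idx exprZn.
by rewrite size_scale ?expf_neq0 // size_polyXn ltnn.
Qed.

Lemma lsop_dual :
  (exists D : P -> 'rV[int]_n, forall i j, i \in atoms s -> j \in atoms s ->
     pairing (D i) (l j) = (i == j)%:R) /\
  (forall a, (forall i, i \in atoms s -> pairing a (l i) = 0) -> a = 0).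
Proof.
split; last first.
  move=> a a0; rewrite -[a](mulmxK coefs_unit); have -> : a *m coefs = 0.
    by apply/rowP => k; rewrite -pairing_idx a0 // mxE.
  by rewrite mul0mx.
suff /choice[D DE] : forall i, exists a, i \in atoms s ->
    forall j, j \in atoms s -> pairing a (l j) = (i == j)%:R.
  by exists D => i j is_; apply: DE.
move=> i; have [/idx_surj[k ->]|_] := boolP (i \in atoms s); last by exists 0.
exists (row k (invmx coefs)) => _ j /idx_surj[k' ->].
by rewrite pairing_idx -row_mul mulVmx // !mxE (inj_eq idx_inj).
Qed.

End TopSimplex.
End LsopTheory.

(** * The graph of a pseudomanifold *)

Section GraphOfPosetTheory.
Variables (d : Order.disp_t) (P : finBPOrderType d) (n : nat).
Hypothesis pmP : pseudomanifold P n.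
Notation Gm := (Gamma P n).
Implicit Types (e : edge Gm) (s : vert Gm).

Let sP : simplicial P. Proof. by case: pmP. Qed.

Lemma rk_top s : rk (val s) = n.
Proof. exact/eqP/(valP s). Qed.

Lemma rk_wall e : (rk (flag_wall e)).+1 = n.
Proof. by have /andP[_ /eqP] := valP e. Qed.

Lemma wall_src e : (flag_wall e <= val (src e))%O.
Proof. by have /andP[+ _] := valP e; rewrite inE => /and3P[]. Qed.

Lemma wall_rev e : flag_wall (Defs.rev e : edge Gm) = flag_wall e.
Proof. by []. Qed.

Lemma wall_tgt e : (flag_wall e <= val (tgt e))%O.
Proof. by rewrite -wall_rev wall_src. Qed.

Lemma flag_edgeE e : val e = (src e, tgt e, flag_wall e).
Proof. by case: e => -[[]]. Qed.

Lemma wall_lt (w : P) s : (rk w).+1 = n -> (w <= val s)%O -> (w < val s)%O.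
Proof.
move=> wn ws; rewrite lt_neqAle ws andbT; apply: contra_eqN wn => /eqP ->.
by rewrite rk_top gtn_eqF.
Qed.

(** A wall lies in exactly two top simplices. Hence an edge is determined by its source and its
    wall. *)
Lemma wall_coface (w : P) s s' s'' : (rk w).+1 = n ->
  (w <= val s)%O -> (w <= val s')%O -> (w <= val s'')%O ->
  s != s' -> s != s'' -> s' = s''.
Proof.
move=> wn ws ws' ws'' ss' ss''; apply: val_inj.
have [_ _ /(_ w wn) c2 _] := pmP.
have inW (t : vert Gm) : (w <= val t)%O -> val t \in [set t : P | (w < t)%O && (rk t == n)].
  by move=> wt; rewrite inE wall_lt //= rk_top.
move: c2; rewrite (cardsD1 (val s)) inW // => -[] /eqP/cards1P[t /setP tE].
have := tE (val s'); have := tE (val s''); rewrite !in_setD1 !inW // !in_set1.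
by rewrite !(inj_eq val_inj) !(eq_sym _ s) ss' ss'' => /esym/eqP-> /esym/eqP->.
Qed.

Lemma edge_wall_inj e e' : src e = src e' -> flag_wall e = flag_wall e' -> e = e'.
Proof.
move=> se we; apply: val_inj; rewrite !flag_edgeE se we; congr (_, _, _).
apply: (@wall_coface (flag_wall e) (src e)); rewrite ?rk_wall ?wall_src ?wall_tgt //.
- by rewrite we wall_tgt.
- by rewrite eq_sym loopless.
- by rewrite se eq_sym loopless.
Qed.

Lemma edge_wall_ex (w : P) s : (rk w).+1 = n -> (w <= val s)%O ->
  exists2 e, src e = s & flag_wall e = w.
Proof.
move=> wn ws; have [_ _ /(_ w wn) c2 _] := pmP.
move: c2; rewrite (cardsD1 (val s)) inE wall_lt //= rk_top eqxx.
move=> [] /eqP/cards1P[t tE]; have : t \in [set t] by rewrite inE.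
rewrite -tE !inE => /and3P[ts wt tn].
(* A larger common lower bound would have rank n, and so would equal both [val s] and [t]. *)
have wm : w \in meets (val s) t.
  rewrite inE ws (ltW wt); apply/forallP => u; apply/implyP => /and3P[us ut wu].
  rewrite eq_sym; apply/eqP/(le_rk_eq sP wu); rewrite -ltnS wn -(rk_top s).
  apply: (rk_lt sP); rewrite lt_neqAle us andbT; apply: contraNneq ts => us'.
  rewrite -us'; apply/eqP/esym/(le_rk_eq sP) => //.
  by rewrite (eqP tn) us' rk_top.
pose t' : top_simplex P n := Sub t tn.
have eP : ((s, t', w).2 \in meets (val s) (val t')) && ((rk w).+1 == n) by rewrite /= wm wn eqxx.
by exists (exist _ (s, t', w) eP).
Qed.

(** * Edges at a top simplex, labelled by the vertex opposite to their wall *)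

Definition missing e : P :=
  odflt \bot%O [pick j in atoms (val (src e)) :\: atoms (flag_wall e)].

Lemma missingP e : missing e \in atoms (val (src e)) /\
  atoms (flag_wall e) = atoms (val (src e)) :\ missing e.
Proof.
have ws := atoms_le (wall_src e).
have : #|atoms (val (src e)) :\: atoms (flag_wall e)| == 1%N.
  rewrite cardsD (setIidPr ws) !(card_atoms sP) rk_top.
  by rewrite -[X in (X - _)%N](rk_wall e) subSnn.
case/cards1P => j jE; have -> : missing e = j.
  rewrite /missing; case: pickP => [k|/(_ j)].
    by rewrite jE inE => /eqP.
  by rewrite jE inE eqxx.
split; first by have /setP/(_ j) := jE; rewrite !inE eqxx => /andP[_].
by rewrite -jE setDDr setDv set0U; apply/esym/setIidPr.
Qed.

Lemma missing_src e : missing e \in atoms (val (src e)).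
Proof. by case: (missingP e). Qed.

Lemma atoms_wall e : atoms (flag_wall e) = atoms (val (src e)) :\ missing e.
Proof. by case: (missingP e). Qed.

Lemma missing_inj e e' : src e = src e' -> missing e = missing e' -> e = e'.
Proof.
move=> se me; apply: edge_wall_inj => //.
apply: (atoms_inj sP (wall_src e)); first by rewrite se wall_src.
by rewrite !atoms_wall se me.
Qed.

Lemma missing_ex s (i : P) : i \in atoms (val s) -> exists2 e, src e = s & missing e = i.
Proof.
move=> is_; have [w ws wE] : exists2 w, (w <= val s)%O & atoms w = atoms (val s) :\ i.
  by apply: (atoms_ex sP); rewrite subsetDl.
have wn : (rk w).+1 = n.
  by rewrite -(rk_top s) -!(card_atoms sP) wE [RHS](cardsD1 i) is_.
have [e es ew] := edge_wall_ex wn ws; exists e => //.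
have : missing e \notin atoms w by rewrite -ew atoms_wall !inE eqxx.
by rewrite wE in_setD1 negb_and negbK -es missing_src orbF => /eqP.
Qed.

Lemma missing_not_wall e (j : P) : rk j = 1%N -> (j <= val (src e))%O ->
  ~~ (j <= flag_wall e)%O -> j = missing e.
Proof.
move=> j1 js jw; have : j \notin atoms (flag_wall e) by rewrite inE negb_and jw orbT.
rewrite atoms_wall in_setD1 negb_and negbK => /orP[/eqP//|/negP[]].
exact/atomsP.
Qed.

Lemma missing_wall e : ~~ (missing e <= flag_wall e)%O.
Proof.
apply/negP => mw; have : missing e \in atoms (flag_wall e).
  by apply/atomsP; split=> //; have /atomsP[] := missing_src e.
by rewrite atoms_wall !inE eqxx.
Qed.

Lemma card_star_Gamma s : #|star s| = n.
Proof.
rewrite -[RHS](rk_top s) -(card_atoms sP).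
have -> : atoms (val s) = missing @: star s.
  apply/setP => i; apply/idP/imsetP => [/missing_ex[e es <-]|[e]].
    by exists e; rewrite // inE es.
  by rewrite inE => /eqP <- ->; apply: missing_src.
rewrite card_in_imset // => e e'; rewrite !inE => /eqP es /eqP es'.
by apply: missing_inj; rewrite es es'.
Qed.

Lemma Gamma_connected : graph_connected Gm.
Proof.
have [_ [le_top _] _ con] := pmP; split.
  have [t _ tn] := le_top \bot%O; apply/card_gt0P.
  by exists (Sub t (introT eqP tn) : top_simplex P n).
move=> p q; have /connectP[c pc qE] := con _ _ (rk_top p) (rk_top q).
elim: c p pc qE => [|t c IH] p /=; first by move=> _ /val_inj ->; apply: connect0.
case/andP => /and3P[_ tn /existsP[w /andP[wm wn]]] pc qE.
pose t' : vert Gm := Sub t tn.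
apply: (@connect_trans _ _ t'); last exact: IH.
apply: connect1; apply/existsP; rewrite /=.
have eP : ((p, t', w).2 \in meets (val p) (val t')) && ((rk w).+1 == n) by rewrite /= wm wn.
by exists (exist _ (p, t', w) eP); rewrite inE /flag_src /= !eqxx.
Qed.

(** The bijection between the vertices of two adjacent simplices: the identity on the wall, and
    opposite vertex to opposite vertex. *)
Definition move_atom e (i : P) : P := if i == missing e then missing (Defs.rev e) else i.

(** The connection, read through opposite vertices. By [transportP] the default value does not occur
    when [e'] and [e] have the same source. *)
Definition transport e e' : edge Gm :=
  odflt e' [pick e'' | (src e'' == tgt e) && (missing e'' == move_atom e (missing e'))].

Lemma transportP e e' : src e' = src e ->
  src (transport e e') = tgt e /\ missing (transport e e') = move_atom e (missing e').
Proof.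
move=> se; rewrite /transport; case: pickP => [e'' /andP[/eqP-> /eqP->]//|].
have [e'' <- <-] : exists2 e'', src e'' = tgt e & missing e'' = move_atom e (missing e').
  apply: missing_ex; rewrite /move_atom; case: eqP => [_|/eqP ne].
    exact: missing_src.
  apply: (subsetP (atoms_le (wall_tgt e))); rewrite atoms_wall in_setD1 ne -se.
  exact: missing_src.
by move/(_ e''); rewrite !eqxx.
Qed.

Lemma transport_connection : is_connection transport.
Proof.
split=> [e e' /transportP[]//|e e' se|e].
- have [s1 m1] := transportP se.
  have [s2 m2] : src (transport (Defs.rev e) (transport e e')) = tgt (Defs.rev e) /\ _ :=
    transportP s1.
  apply: missing_inj; first by rewrite s2 /tgt Defs.revK.
  rewrite m2 m1 /move_atom Defs.revK; case: (missing e' =P missing e) => [->|/eqP ne].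
    by rewrite eqxx.
  (* Equality would place the vertex opposite to the wall inside the wall. *)
  case: eqP => // m; case/negP: (missing_wall (Defs.rev e)); rewrite -m wall_rev.
  have : missing e' \in atoms (flag_wall e).
    by rewrite atoms_wall in_setD1 ne -se missing_src.
  by case/atomsP.
- have [s1 m1] := transportP (erefl (src e)).
  by apply: missing_inj; rewrite // m1 /move_atom eqxx.
Qed.

(** * The axial function given by dual bases *)

Section Axial.
Variable l : P -> 'cV[int]_n.
Hypothesis l_dual : forall s : vert Gm,
  (exists D : P -> 'rV[int]_n, forall i j, i \in atoms (val s) -> j \in atoms (val s) ->
     pairing (D i) (l j) = (i == j)%:R) /\
  (forall a, (forall i, i \in atoms (val s) -> pairing a (l i) = 0) -> a = 0).
Variable alpha : edge Gm -> 'rV[int]_n.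
Hypothesis alphaE : forall e i, i \in atoms (val (src e)) ->
  pairing (alpha e) (l i) = (i == missing e)%:R.

Lemma pairing_eq s a b :
  (forall i, i \in atoms (val s) -> pairing a (l i) = pairing b (l i)) -> a = b.
Proof.
move=> ab; apply/eqP; rewrite -subr_eq0; apply/eqP.
by apply: (proj2 (l_dual s)) => i is_; rewrite pairingB ab ?subrr.
Qed.

(** The vectors killed by the functionals of a wall form a lattice of rank one, generated by
    [alpha e]. This depends on the wall alone, and so allows comparison of the two ends of [e]. *)
Lemma wall_annihilator e a :
  (forall i, i \in atoms (flag_wall e) -> pairing a (l i) = 0) ->
  a = pairing a (l (missing e)) *: alpha e.
Proof.
move=> a0; apply: (@pairing_eq (src e)) => i is_; rewrite pairingZ alphaE //.
have [->|im] := eqVneq i (missing e); first by rewrite mulr1.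
by rewrite mulr0 a0 // atoms_wall in_setD1 im.
Qed.

Lemma pairing_alpha_wall e i : i \in atoms (flag_wall e) -> pairing (alpha e) (l i) = 0.
Proof. by rewrite atoms_wall in_setD1 => /andP[/negPf ie /alphaE ->]; rewrite ie. Qed.

(** Both vectors generate the annihilator of the same wall, so they differ by a unit of the
    integers. *)
Lemma alpha_rev e : alpha (Defs.rev e) = alpha e \/ alpha (Defs.rev e) = - alpha e.
Proof.
have := wall_annihilator (e := e) (a := alpha (Defs.rev e)) (@pairing_alpha_wall (Defs.rev e)).
have := wall_annihilator (e := Defs.rev e) (a := alpha e) (@pairing_alpha_wall e).
set c' := pairing _ _ => eE; set c := pairing _ _ => rE.
have : c' * c = 1.
  have := alphaE (missing_src e); rewrite eqxx {1}eE rE scalerA pairingZ alphaE ?missing_src //.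
  by rewrite eqxx mulr1.
move/intUnitRing.unitzPl; rewrite unfold_in => /orP[] /eqP c1; rewrite rE c1.
  by left; rewrite scale1r.
by right; rewrite scaleN1r.
Qed.

Lemma alpha_basis s : is_Zbasis (star s) alpha.
Proof.
have alpha_missing e e' : e \in star s -> e' \in star s ->
    pairing (alpha e) (l (missing e')) = (e == e')%:R.
  rewrite !inE => /eqP es /eqP es'; rewrite alphaE ?es -?es' ?missing_src //.
  congr (nat_of_bool _)%:R; apply/eqP/eqP => [/missing_inj E|->//].
  by rewrite E // es es'.
have pairing_star (c : edge Gm -> int) e : e \in star s ->
    pairing (\sum_(e' in star s) c e' *: alpha e') (l (missing e)) = c e.
  move=> es; rewrite pairing_sum (bigD1 e) //= big1 ?addr0.
    by rewrite pairingZ alpha_missing // eqxx mulr1.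
  move=> e' /andP[es' /negPf ee']; rewrite pairingZ alpha_missing // ee' mulr0 //.
split=> [x|c c0 e es].
  exists (fun e => pairing x (l (missing e))); apply: (@pairing_eq s) => i.
  move=> /missing_ex[e es <-]; rewrite (pairing_star (fun e => _)) // inE.
  exact/eqP.
by rewrite -(pairing_star c) // c0 /pairing mul0mx mxE.
Qed.

(** The two labels pair equally with each vertex of the wall, since [move_atom] changes only the
    opposite vertex; their difference therefore annihilates the wall. *)
Lemma alpha_transport e e' : src e' = src e ->
  exists c, alpha (transport e e') - alpha e' = c *: alpha e.
Proof.
move=> se; have [s1 m1] := transportP se; eexists; apply: wall_annihilator => i iw.
have is_ := subsetP (atoms_le (wall_src e)) _ iw.
have it := subsetP (atoms_le (wall_tgt e)) _ iw.
rewrite pairingB !alphaE ?s1 ?se // m1 /move_atom.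
case: (missing e' =P missing e) => [->|_]; last by rewrite subrr.
have -> : (i == missing e) = false.
  by move: iw; rewrite atoms_wall in_setD1 => /andP[/negPf].
have -> : (i == missing (Defs.rev e)) = false.
  by move: iw; rewrite -wall_rev atoms_wall in_setD1 => /andP[/negPf].
by rewrite subrr.
Qed.

Lemma Gamma_torus_graph : is_torus_graph alpha transport.
Proof.
split; [exact: Gamma_connected|exact: card_star_Gamma|exact: transport_connection|].
by split; [exact: alpha_rev|exact: alpha_basis|exact: alpha_transport].
Qed.

End Axial.

Lemma torus_graph_of_poset (lam : {additive 'rV[int]_n -> face_ring P}) :
  is_lsop_hom lam ->
  exists alpha : edge Gm -> 'rV[int]_n,
    [/\ constructed_axial lam alpha,
        (forall alpha', constructed_axial lam alpha' -> alpha' =1 alpha) &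
        exists theta, is_torus_graph alpha theta].
Proof.
move=> lamP; have [l lamE] := lsop_hom_coef sP lamP.
have l_dual (s : vert Gm) := lsop_dual sP lamP lamE (rk_top s).
have /choice[alpha alphaE] : forall e, exists a, forall i, i \in atoms (val (src e)) ->
    pairing a (l i) = (i == missing e)%:R.
  move=> e; have [[D DE] _] := l_dual (src e); exists (D (missing e)) => i is_.
  by rewrite DE ?missing_src // eq_sym.
exists alpha; split; last by exists transport; apply: Gamma_torus_graph l_dual _ alphaE.
  exists l => // e i j i1 is_ j1 js jw; rewrite alphaE; last exact/atomsP.
  by rewrite -(missing_not_wall j1 js jw).
move=> alpha' [l' lamE' alphaE'] e.
apply: (pairing_eq l_dual (s := src e)) => i /[dup] is_ /atomsP[i1 ils].
(* [l'] and [l] are both coefficients of [lam], and the classes of rank one are linearly independent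
   ([face_ring_coef]). *)
have <- : pairing (alpha' e) (l' i) = pairing (alpha' e) (l i).
  apply/eqP; rewrite -subr_eq0; apply/eqP.
  pose c v := pairing (alpha' e) (l' v) - pairing (alpha' e) (l v).
  apply: (face_ring_coef sP (c := c)) => //.
  under eq_bigr do rewrite mulrzBr.
  by rewrite sumrB -lamE -lamE' subrr.
have /atomsP[m1 ms] := missing_src e.
by rewrite alphaE // (alphaE' e i (missing e)) // missing_wall.
Qed.

End GraphOfPosetTheory.

(** * Faces of a torus graph *)

Section TorusGraphFaces.
Variables (n : nat) (G : torus_graph n).
Implicit Types (e : edge G) (p q : vert G) (F : face G).

Let conn_axiom : is_connection (@conn n G). Proof. by case: (tg_axiom G). Qed.

Lemma star_src e : e \in star (src e). Proof. by rewrite inE. Qed.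

Lemma card_star p : #|star p| = n. Proof. by case: (tg_axiom G). Qed.

Lemma src_conn e e' : src e' = src e -> src (conn e e') = tgt e.
Proof. by case: conn_axiom => + _ _; apply. Qed.

Lemma connK e e' : src e' = src e -> conn (Defs.rev e) (conn e e') = e'.
Proof. by case: conn_axiom => _ + _; apply. Qed.

Lemma connKV e e' : src e' = tgt e -> conn e (conn (Defs.rev e) e') = e'.
Proof. by move=> /connK; rewrite Defs.revK. Qed.

Lemma src_conn_rev e e' : src e' = tgt e -> src (conn (Defs.rev e) e') = src e.
Proof. by move=> /src_conn; rewrite /tgt Defs.revK. Qed.

Lemma axial_rev e : axial (Defs.rev e) = axial e \/ axial (Defs.rev e) = - axial e.
Proof. by case: (tg_axiom G) => _ _ _ []. Qed.

Lemma axial_basis p : is_Zbasis (star p) (@axial n G).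
Proof. by case: (tg_axiom G) => _ _ _ []. Qed.

Lemma axial_conn e e' : src e' = src e -> exists c, axial (conn e e') = axial e' + c *: axial e.
Proof.
case: (tg_axiom G) => _ _ _ [_ _ axc] /axc[c cE]; exists c.
by rewrite -cE addrC subrK.
Qed.

Lemma axial_basis_eq p (c c' : edge G -> int) :
  \sum_(e in star p) c e *: axial e = \sum_(e in star p) c' e *: axial e ->
  forall e, e \in star p -> c e = c' e.
Proof.
move=> cc' e ep; apply/eqP; rewrite -subr_eq0; apply/eqP.
apply: (proj2 (axial_basis p) (fun e => c e - c' e)) ep.
by under eq_bigr do rewrite scalerBl; rewrite sumrB cc' subrr.
Qed.

Lemma face_kface F : exists2 k, (k <= n)%N & is_kface k (face_verts F, face_edges F).
Proof.
have /existsP[k Fk] := valP F; exists k; first by rewrite -ltnS.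
by rewrite -surjective_pairing.
Qed.

Lemma face_edge_rev F e : e \in face_edges F -> Defs.rev e \in face_edges F.
Proof. by have [k _ /and5P[_ /forall_inP h _ _ _]] := face_kface F; move/h => /andP[]. Qed.

Lemma face_edge_src F e : e \in face_edges F -> src e \in face_verts F.
Proof. by have [k _ /and5P[_ /forall_inP h _ _ _]] := face_kface F; move/h => /andP[]. Qed.

Lemma face_edge_tgt F e : e \in face_edges F -> tgt e \in face_verts F.
Proof. by move/face_edge_rev/face_edge_src. Qed.

Lemma face_conn F e e' : e \in face_edges F -> e' \in face_edges F ->
  src e' = src e -> conn e e' \in face_edges F.
Proof.
have [k _ /and5P[_ _ _ _ /forall_inP h]] := face_kface F.
by move=> eF e'F se; have /forall_inP/(_ _ e'F)/implyP := h _ eF; apply; apply/eqP.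
Qed.

Lemma face_conn_iff F e e' : e \in face_edges F -> src e' = src e ->
  (conn e e' \in face_edges F) = (e' \in face_edges F).
Proof.
move=> eF se; apply/idP/idP => [cF|e'F]; last exact: face_conn.
by rewrite -(connK se) face_conn ?face_edge_rev // src_conn.
Qed.

Lemma face_vert_ex F : exists p, p \in face_verts F.
Proof. by have [k _ /and5P[/set0Pn]] := face_kface F. Qed.

Lemma face_ind F p (Q : vert G -> Prop) : p \in face_verts F -> Q p ->
  (forall e, e \in face_edges F -> Q (src e) -> Q (tgt e)) ->
  forall q, q \in face_verts F -> Q q.
Proof.
have [k _ /and5P[_ _ /forall_inP h _ _]] := face_kface F.
move=> pF Qp step q qF; have /forall_inP/(_ _ qF)/connectP[c] := h _ pF.
elim: c p {pF} Qp => [|q' c IH] p Qp /=; first by move=> _ ->.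
case/andP => /exists_inP[e eF /andP[/eqP se /eqP te]] pc qE.
by apply: IH pc qE; rewrite -te; apply: step => //; rewrite se.
Qed.

Lemma leFE F F' : (F <= F')%O =
  (face_verts F' \subset face_verts F) && (face_edges F' \subset face_edges F).
Proof. by []. Qed.

(** Containment at one common vertex spreads along the edges of [F']: these then lie in [F] too, and
    their connection preserves membership in both faces. *)
Lemma le_face F F' p : p \in face_verts F -> p \in face_verts F' ->
  (F <= F')%O = (star p :&: face_edges F' \subset face_edges F).
Proof.
move=> pF pF'; rewrite leFE; apply/andP/idP => [[_ sF]|sp].
  by apply: subset_trans sF; rewrite subsetIr.
pose Q q := q \in face_verts F /\ star q :&: face_edges F' \subset face_edges F.
have QF' q : q \in face_verts F' -> Q q.
  apply: (face_ind pF') => // e eF' [eF /subsetP sub].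
  have {}eF : e \in face_edges F by apply: sub; rewrite inE star_src.
  split; first exact: face_edge_tgt.
  apply/subsetP => e''; rewrite !inE => /andP[/eqP se'' e''F'].
  have se' := src_conn_rev se''; rewrite -(connKV se'') face_conn_iff //.
  apply: sub; rewrite !inE se' eqxx /=.
  by rewrite face_conn_iff // ?face_edge_rev.
split; first by apply/subsetP => q /QF'[].
apply/subsetP => e eF'.
have [_ /subsetP] := QF' _ (face_edge_src eF'); apply.
by rewrite inE star_src.
Qed.

Lemma face_eq F F' p : p \in face_verts F -> p \in face_verts F' ->
  star p :&: face_edges F = star p :&: face_edges F' -> F = F'.
Proof.
move=> pF pF' E; apply/eqP; rewrite eq_le (le_face pF pF') (le_face pF' pF).
by rewrite -E {2}E !subsetIr.
Qed.

(* The face through [p] spanned by [A]: condition (iii) makes the lattice      *)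
(* spanned by [alpha A] invariant along the edges whose label lies in it, so   *)
(* the face is a component of the graph of these edges.                        *)
Lemma face_span p (A : {set edge G}) : A \subset star p ->
  exists2 F, p \in face_verts F & star p :&: face_edges F = A.
Proof.
move=> /subsetP Ap.
pose L (x : 'rV[int]_n) := exists c : edge G -> int, x = \sum_(e in A) c e *: axial e.
have LD x y : L x -> L y -> L (x + y).
  case=> [c ->] [c' ->]; exists (fun e => c e + c' e); rewrite -big_split.
  by apply: eq_bigr => e _; rewrite scalerDl.
have LZ z x : L x -> L (z *: x).
  case=> [c ->]; exists (fun e => z * c e); rewrite scaler_sumr.
  by apply: eq_bigr => e _; rewrite scalerA.
pose E0 := [set e : edge G | `[< L (axial e) >]].
have E0P e : reflect (L (axial e)) (e \in E0) by rewrite inE; apply: asboolP.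
have E0rev e : e \in E0 -> Defs.rev e \in E0.
  move=> /E0P Le; apply/E0P; case: (axial_rev e) => -> //.
  by rewrite -scaleN1r; apply: LZ.
have E0conn e e' : e \in E0 -> e' \in E0 -> src e' = src e -> conn e e' \in E0.
  move=> /E0P Le /E0P Le' /axial_conn[c cE]; apply/E0P; rewrite cE.
  by apply: (LD) => //; apply: (LZ).
pose V := [set q | connect (adj E0) p q].
have Vstep e : e \in E0 -> src e \in V -> tgt e \in V.
  move=> eE; rewrite !inE => /connect_trans; apply; apply: connect1.
  by apply/exists_inP; exists e; rewrite ?eqxx.
pose E := [set e in E0 | src e \in V].
have EP e : (e \in E) = (e \in E0) && (src e \in V) by rewrite inE.
have pV : p \in V by rewrite inE connect0.
have Vind (Q : vert G -> Prop) : Q p ->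
    (forall e, e \in E0 -> src e \in V -> Q (src e) -> Q (tgt e)) -> forall q, q \in V -> Q q.
  move=> Qp step q; rewrite inE => /connectP[c pc ->].
  suff gen r : r \in V -> Q r -> path (adj E0) r c -> Q (last r c) by apply: gen.
  elim: c {pc} r => //= q' c IH r rV Qr /andP[/exists_inP[e eE /andP[/eqP se /eqP te]]].
  have eV : src e \in V by rewrite se.
  by apply: IH; rewrite -te; [exact: Vstep|apply: step; rewrite ?se].
have Erev e : e \in E -> Defs.rev e \in E.
  by rewrite !EP => /andP[eE eV]; rewrite E0rev //= Vstep.
have pE q : q \in V -> connect (adj E) p q.
  apply: (Vind (fun q => connect (adj E) p q)) => [|e eE eV]; first exact: connect0.
  move/connect_trans; apply; apply: connect1; apply/exists_inP; exists e; last by rewrite !eqxx.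
  by rewrite EP eE.
have symE : connect_sym (adj E).
  apply: sym_connect_sym => q r; rewrite /adj /=.
  by apply/exists_inP/exists_inP => -[e eE /andP[qe re]]; exists (Defs.rev e);
    rewrite ?Erev // /tgt Defs.revK qe andbT.
have starE q : q \in V -> star q :&: E = star q :&: E0.
  move=> qV; apply/setP => e; rewrite !in_setI EP [e \in star q]inE.
  by case: eqP => //= ->; rewrite qV andbT.
have starp : star p :&: E0 = A.
  apply/setP => e; rewrite in_setI; apply/andP/idP => [[ep /E0P[c cE]]|eA]; last first.
    split; first exact: Ap.
    apply/E0P; exists (fun e' => (e' == e)%:R); rewrite (bigD1 e) //= eqxx scale1r.
    by rewrite big1 ?addr0 // => e' /andP[_ /negPf->]; rewrite scale0r.
  (* An edge at [p] outside [A] with label in the lattice would have two different coordinate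
     vectors in the basis at [p]. *)
  apply: contrapT => /negP eA.
  have E1 : \sum_(e' in star p) (e' == e)%:R *: axial e' =
      \sum_(e' in star p) (if e' \in A then c e' else 0) *: axial e'.
    rewrite (bigD1 e) //= eqxx scale1r big1 ?addr0 => [|e' /andP[_ /negPf->]]; last first.
      by rewrite scale0r.
    rewrite cE big_mkcond [RHS]big_mkcond; apply: eq_bigr => e' _.
    by have [/Ap->//|_] := boolP (e' \in A); rewrite scale0r if_same.
  by have /eqP := axial_basis_eq E1 ep; rewrite eqxx (negPf eA) oner_eq0.
(* [conn e] is injective on the star and preserves [E0]; applied to [e] and its reverse, this makes
   the valence constant. *)
have card_le e : e \in E0 -> (#|star (src e) :&: E0| <= #|star (tgt e) :&: E0|)%N.
  move=> eE; rewrite -(card_in_imset (f := conn e)).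
    apply: subset_leq_card; apply/subsetP => _ /imsetP[e' + ->].
    rewrite !in_setI [e' \in star _]inE => /andP[/eqP se LE].
    by rewrite [_ \in star _]inE src_conn // eqxx; apply: E0conn.
  move=> e1 e2; rewrite !in_setI ![_ \in star _]inE => /andP[/eqP s1 _] /andP[/eqP s2 _] E12.
  by rewrite -(connK s1) E12 connK.
have cardE q : q \in V -> #|star q :&: E| = #|A|.
  move=> qV; rewrite (starE _ qV); move: q qV.
  apply: (Vind (fun q => #|star q :&: E0| = #|A|)) => [|e eE eV <-]; first by rewrite starp.
  apply/eqP; rewrite eqn_leq card_le // andbT.
  by have := card_le _ (E0rev _ eE); rewrite /tgt Defs.revK.
have An : (#|A| < n.+1)%N.
  by rewrite ltnS -[leqRHS](card_star p) subset_leq_card //; apply/subsetP.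
have FP : is_face (V, E).
  apply/existsP; exists (Ordinal An); apply/and5P; split=> /=.
  - by apply/set0Pn; exists p.
  - apply/forall_inP => e eE; rewrite Erev //=.
    by move: eE; rewrite EP => /andP[].
  - apply/forall_inP => q qV; apply/forall_inP => r rV.
    by apply: (@connect_trans _ _ p); [rewrite symE|]; apply: pE.
  - by apply/forall_inP => q qV; rewrite cardE.
  - apply/forall_inP => e; rewrite EP => /andP[eE eV].
    apply/forall_inP => e'; rewrite EP => /andP[e'E _]; apply/implyP => /eqP se.
    by rewrite EP E0conn // src_conn // Vstep.
exists (exist _ (V, E) FP) => //.
by rewrite -[RHS]starp -(starE _ pV).
Qed.

Definition face_at p (A : {set edge G}) : face G :=
  odflt (whole_face G) [pick F | (p \in face_verts F) && (star p :&: face_edges F == A)].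

Lemma face_atP p (A : {set edge G}) : A \subset star p ->
  p \in face_verts (face_at p A) /\ star p :&: face_edges (face_at p A) = A.
Proof.
move=> /face_span[F pF FA]; rewrite /face_at; case: pickP => [F' /andP[? /eqP]//|/(_ F)].
by rewrite pF FA eqxx.
Qed.

Lemma vert_face_at p (A : {set edge G}) : A \subset star p -> p \in face_verts (face_at p A).
Proof. by case/face_atP. Qed.

Lemma edge_face_at p (A : {set edge G}) e : A \subset star p -> e \in star p ->
  (e \in face_edges (face_at p A)) = (e \in A).
Proof. by case/face_atP => _ /setP/(_ e) <- ep; rewrite in_setI ep. Qed.

(** Every [F' <= F] contains [F], hence [p], and is determined by the edges at [p] that it omits;
    these form an arbitrary subset of those omitted by [F]. *)
Lemma simplex_face F p : p \in face_verts F -> is_simplex #|star p :\: face_edges F| F.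
Proof.
move=> pF; set C := _ :\: _.
have sub (B : {set 'I_#|C|}) : star p :\: (enum_val @: B) \subset star p by rewrite subsetDl.
have enumC (x : 'I_#|C|) : enum_val x \in C by apply: enum_valP.
apply/is_simplexP; exists (fun B : {set 'I_#|C|} => face_at p (star p :\: (enum_val @: B))).
split=> [B B'|F'].
  rewrite (@le_face _ _ p) ?vert_face_at // (proj2 (face_atP (sub B'))).
  apply/subsetP/subsetP => [h x xB|h e].
    apply: contrapT => /negP xB'.
    have xp : enum_val x \in star p by have := enumC x; rewrite inE => /andP[].
    have xi (B0 : {set 'I_#|C|}) : (enum_val x \in [set enum_val y | y in B0]) = (x \in B0).
      by rewrite mem_imset //; apply: enum_val_inj.
    have := h (enum_val x); rewrite edge_face_at // !in_setD xp !xi xB xB' /=.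
    by move/(_ isT).
  rewrite in_setD => /andP[eB' ep]; rewrite edge_face_at // in_setD ep andbT.
  by apply: contra eB' => /imsetP[x /h xB' ->]; apply: imset_f.
split=> [F'F|[B <-]]; last first.
  rewrite (@le_face _ _ p) ?vert_face_at //; apply/subsetP => e /[!in_setI] /andP[ep eF].
  rewrite edge_face_at // in_setD ep andbT; apply/imsetP => -[x _ xe].
  by have := enumC x; rewrite -xe in_setD eF.
have pF' : p \in face_verts F'.
  by move: F'F; rewrite leFE => /andP[/subsetP + _]; apply.
exists [set x | enum_val x \notin face_edges F'].
apply: (@face_eq _ _ p) => //; first exact: vert_face_at.
rewrite (proj2 (face_atP (sub _))); apply/setP => e; rewrite in_setD in_setI andbC.
have [ep|//] := boolP (e \in star p); apply/negP/idP => [eI|eF' /imsetP[x]]; last first.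
  by rewrite inE => /negP + xe; rewrite -xe.
apply: contrapT => /negP eF'; apply: eI.
have eC : e \in C.
  rewrite in_setD ep andbT; apply: contra eF'.
  by move: F'F; rewrite leFE => /andP[_ /subsetP]; apply.
by apply/imsetP; exists (enum_rank_in eC e); rewrite ?inE enum_rankK_in.
Qed.

Lemma face_simplicial : simplicial (face G).
Proof. by move=> F; have [p /simplex_face] := face_vert_ex F; eexists; eassumption. Qed.

Lemma rk_face F p : p \in face_verts F -> rk F = #|star p :\: face_edges F|.
Proof. by move/simplex_face/rk_simplex. Qed.

Lemma card_star_face F p : p \in face_verts F ->
  (#|star p :&: face_edges F| + rk F = n)%N.
Proof. by move=> pF; rewrite (rk_face pF) cardsID card_star. Qed.

(** * Vertices, facets and edges as faces *)

Definition vertex_face p := face_at p set0.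
Definition facet_at e := face_at (src e) (star (src e) :\ e).
Definition edge_face e := face_at (src e) [set e].

Lemma verts_vertex_face p : face_verts (vertex_face p) = [set p].
Proof.
have pF := vert_face_at (sub0set (star p)).
have E0 := proj2 (face_atP (sub0set (star p))).
apply/setP => q; rewrite inE; apply/idP/eqP => [|->//].
apply: (face_ind (Q := fun q => q = p) pF) => // e eF sp; move/setP/(_ e): E0.
by rewrite in_setI eF !inE sp eqxx.
Qed.

Lemma rk_vertex_face p : rk (vertex_face p) = n.
Proof.
rewrite -[RHS](card_star_face (vert_face_at (sub0set (star p)))).
by rewrite (proj2 (face_atP (sub0set _))) cards0.
Qed.

Lemma le_vertex_face F p : (F <= vertex_face p)%O = (p \in face_verts F).
Proof.
apply/idP/idP => [|pF].
  by rewrite leFE verts_vertex_face sub1set => /andP[].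
rewrite (le_face pF) ?(proj2 (face_atP (sub0set _))) ?sub0set //.
by rewrite vert_face_at ?sub0set.
Qed.

Lemma rk_top_face F p : rk F = n -> p \in face_verts F -> F = vertex_face p.
Proof.
move=> Fn pF; apply: (@face_eq _ _ p) => //; first by rewrite verts_vertex_face inE.
rewrite (proj2 (face_atP (sub0set _))); apply/eqP; rewrite -cards_eq0.
by rewrite -(eqn_add2r (rk F)) card_star_face // add0n Fn.
Qed.

Lemma vertex_face_inj : injective vertex_face.
Proof. by move=> p q /(congr1 (@face_verts n G)); rewrite !verts_vertex_face => /set1_inj. Qed.

Lemma star_edge_face e : star (src e) :&: face_edges (edge_face e) = [set e].
Proof. by apply: (proj2 (face_atP _)); rewrite sub1set star_src. Qed.

Lemma edge_face_mem e : e \in face_edges (edge_face e).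
Proof. by have /setP/(_ e) := star_edge_face e; rewrite !inE !eqxx. Qed.

Lemma edge_face_star F e : (rk F).+1 = n -> e \in face_edges F ->
  star (src e) :&: face_edges F = [set e].
Proof.
move=> Fn eF; apply/eqP; rewrite eq_sym eqEcard sub1set in_setI star_src eF /= cards1.
by rewrite -(leq_add2r (rk F)) card_star_face ?face_edge_src // add1n Fn.
Qed.

Lemma rk_edge_face e : (rk (edge_face e)).+1 = n.
Proof.
rewrite -[RHS](card_star_face (face_edge_src (edge_face_mem e))).
by rewrite star_edge_face cards1.
Qed.

(** Such an [F] has dimension one: it has a single edge at each end of [e], so no walk in [F] leaves
    these ends. *)
Lemma edges_rk1 F e : (rk F).+1 = n -> e \in face_edges F ->
  face_verts F = [set src e; tgt e] /\ face_edges F = [set e; Defs.rev e].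
Proof.
move=> Fn eF; have sF := edge_face_star Fn eF; have tF := edge_face_star Fn (face_edge_rev eF).
have VE : face_verts F = [set src e; tgt e].
  apply/setP => q; apply/idP/idP => [|/set2P[]->]; [|exact: face_edge_src|exact: face_edge_tgt].
  apply: (face_ind (Q := fun q => q \in [set src e; tgt e]) (face_edge_src eF)).
    by rewrite !inE eqxx.
  move=> e' e'F.
  case/set2P => se'.
    have /setP/(_ e') := sF; rewrite in_setI [e' \in star _]inE se' eqxx e'F inE => /esym/eqP->.
    by rewrite !inE eqxx orbT.
  have /setP/(_ e') := tF; rewrite in_setI [e' \in star _]inE se' eqxx e'F inE => /esym/eqP->.
  by rewrite /tgt Defs.revK !inE eqxx.
split=> //; apply/setP => e'; apply/idP/idP => [e'F|/set2P[]->//]; last exact: face_edge_rev.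
have := face_edge_src e'F; rewrite VE => /set2P[] se'.
  by have /setP/(_ e') := sF; rewrite in_setI [e' \in star _]inE se' eqxx e'F !inE => <-.
have /setP/(_ e') := tF; rewrite in_setI [e' \in star _]inE se' eqxx e'F !inE => <-.
by rewrite orbT.
Qed.

Lemma rk1_edge F p : (rk F).+1 = n -> p \in face_verts F ->
  exists2 e, e \in face_edges F & src e = p.
Proof.
move=> Fn pF; have /eqP/cards1P[e eE] : #|star p :&: face_edges F| = 1%N.
  by apply/eqP; rewrite -(eqn_add2r (rk F)) card_star_face // add1n Fn.
by have := set11 e; rewrite -eE in_setI inE => /andP[/eqP ep eF]; exists e.
Qed.

(** A face inside the face of [e] that omits [e] at its source has no edge there. It is then a
    single vertex and cannot contain both ends. *)
Lemma edge_face_meets e :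
  edge_face e \in meets (vertex_face (src e)) (vertex_face (tgt e)).
Proof.
have eF := edge_face_mem e.
rewrite inE !le_vertex_face face_edge_src // face_edge_tgt //=.
apply/forallP => F; apply/implyP => /and3P[].
rewrite !le_vertex_face => pF qF Fe; apply/eqP.
apply: (@face_eq _ _ (src e)) => //; first exact: face_edge_src.
move: Fe; rewrite (le_face (face_edge_src eF) pF) => /subsetP sub.
apply/eqP; rewrite star_edge_face eqEsubset sub1set in_setI star_src.
apply/andP; split.
  apply/subsetP => e' /[dup]; rewrite {1}in_setI => /andP[e's _] /sub e'F.
  by rewrite -star_edge_face in_setI e's.
apply: contrapT => /negP eNF.
have : star (src e) :&: face_edges F = set0.
  apply/setP => e'; rewrite [RHS]inE; apply/negP => /[dup].
  rewrite {1}in_setI => /andP[e's e'F] /sub e'E.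
  have := set11 e; have : e' \in star (src e) :&: face_edges (edge_face e) by rewrite in_setI e's.
  by rewrite star_edge_face inE => /eqP ee'; rewrite -ee' e'F in eNF.
move=> F0; have : F = vertex_face (src e).
  apply: rk_top_face => //; rewrite -[RHS](card_star_face pF) F0 cards0 //.
by move=> FE; move: qF; rewrite FE verts_vertex_face inE (negPf (loopless e)).
Qed.

Lemma face_pseudomanifold : pseudomanifold (face G) n.
Proof.
have rk_n F : (rk F <= n)%N.
  by have [p pF] := face_vert_ex F; rewrite -[leqRHS](card_star_face pF) leq_addl.
split; [exact: face_simplicial| | |].
- split=> // F; have [p pF] := face_vert_ex F.
  by exists (vertex_face p); rewrite ?le_vertex_face ?rk_vertex_face.
- move=> F Fn; have [p pF] := face_vert_ex F; have [e eF _] := rk1_edge Fn pF.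
  have [VE _] := edges_rk1 Fn eF.
  have -> : [set t | (F < t)%O && (rk t == n)] = [set vertex_face (src e); vertex_face (tgt e)].
    apply/setP => F'; rewrite !inE; apply/andP/orP => [[/ltW FF' /eqP F'n]|].
      have [q qF'] := face_vert_ex F'; have F'E := rk_top_face F'n qF'.
      move: FF'; rewrite F'E le_vertex_face VE => /set2P[]->; rewrite eqxx; [by left|by right].
    by case=> /eqP->; rewrite rk_vertex_face lt_neqAle le_vertex_face VE !inE !eqxx ?orbT andbT;
       split=> //; apply: contra_eqN Fn => /eqP->; rewrite rk_vertex_face gtn_eqF.
  by rewrite cards2 (inj_eq vertex_face_inj) eq_sym loopless.
- move=> F F' Fn F'n.
  have [p pF] := face_vert_ex F; have [q qF'] := face_vert_ex F'.
  rewrite (rk_top_face Fn pF) (rk_top_face F'n qF') {Fn F'n pF qF'}.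
  move: q (in_setT q).
  apply: (@face_ind (whole_face G) p (fun q => connect _ (vertex_face p) (vertex_face q))) => //.
  move=> e _ /connect_trans; apply; apply: connect1; rewrite /= !rk_vertex_face eqxx /=.
  by apply/exists_inP; exists (edge_face e); rewrite ?edge_face_meets ?rk_edge_face.
Qed.

End TorusGraphFaces.

(** * The canonical lsop *)

Section Lin.
Variable n : nat.

Fact lin_additive : zmod_morphism (@lin n).
Proof.
by move=> a b; rewrite /lin -sumrB; apply: eq_bigr => j _; rewrite !mxE scalerBl.
Qed.
HB.instance Definition _ := GRing.isZmodMorphism.Build _ _ (@lin n) lin_additive.

Lemma linZ z (a : 'rV[int]_n) : lin (z *: a) = lin a *~ z.
Proof. by rewrite -[z in LHS]intz scaler_int raddfMz. Qed.

Lemma lin_inj : injective (@lin n).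
Proof.
move=> a b ab; apply/rowP => j; have : (lin a)@_U_(j) = (lin b)@_U_(j) by rewrite ab.
have linE (c : 'rV[int]_n) : (lin c)@_U_(j) = c 0 j.
  rewrite /lin raddf_sum (bigD1 j) //= mcoeffZ mcoeffXU eqxx mulr1 big1 ?addr0 // => k kj.
  by rewrite mcoeffZ mcoeffXU (negPf kj) mulr0.
by rewrite !linE.
Qed.

Lemma lin_delta j : lin (delta_mx 0 j : 'rV[int]_n) = 'X_j.
Proof.
rewrite /lin (bigD1 j) //= mxE !eqxx scale1r big1 ?addr0 // => k kj.
by rewrite mxE (negPf kj) andbF scale0r.
Qed.

End Lin.

Lemma prod_congr (R : comNzRingType) (d : R) (I : eqType) (r : seq I)
    (Q : pred I) (f g : I -> R) :
  (forall i, Q i -> exists c, f i - g i = c * d) ->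
  exists c, \prod_(i <- r | Q i) f i - \prod_(i <- r | Q i) g i = c * d.
Proof.
move=> fg; apply: (big_ind2 (fun x y => exists c, x - y = c * d)) => //.
  by exists 0; rewrite subrr mul0r.
move=> x1 x2 y1 y2 [c cE] [c' c'E]; exists (c * y1 + x2 * c').
rewrite mulrDl -mulrA (mulrC y1) mulrA -cE -mulrA -c'E; ring.
Qed.

Section FaceLinear.
Variables (d : Order.disp_t) (P : finBPOrderType d) (n : nat) (l : P -> 'cV[int]_n).

Definition linear_form (a : 'rV[int]_n) : face_ring P :=
  \sum_(v | rk v == 1%N) fv v *~ pairing a (l v).

Fact linear_form_additive : zmod_morphism linear_form.
Proof.
move=> a b; rewrite /linear_form -sumrB; apply: eq_bigr => v _.
by rewrite pairingB mulrzBr.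
Qed.
HB.instance Definition _ := GRing.isZmodMorphism.Build _ _ linear_form linear_form_additive.

Lemma homogeneous_linear_form a : simplicial P -> homogeneous 2 (linear_form a).
Proof.
move=> sP; exists (\sum_(v : P | rk v == 1%N) var v *~ pairing a (l v)).
  by rewrite rmorph_sum; apply: eq_bigr => v _; rewrite rmorphMz.
move=> m; rewrite mcoeff_msupp raddf_sum => /eqP m0.
have [v /andP[v1 vm]] : exists v : P, (rk v == 1%N) && ((var v)@_m != 0).
  apply/existsP; apply: contra_notT m0 => /existsPn h; rewrite big1 // => v v1.
  by have := h v; rewrite v1 /= negbK raddfMz /= => /eqP->; rewrite mul0rz.
move: vm; rewrite /var; case: insubP => [x _ xv|vb].
  rewrite mcoeffX; have [<- _|_] := eqVneq U_(enum_rank (x : gen P))%MM m; last by rewrite eqxx.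
  rewrite /wdeg (bigD1 (enum_rank (x : gen P))) //= mnm1E eqxx enum_rankK mul1n big1.
    by rewrite addn0 xv (eqP v1).
  by move=> i ix; rewrite mnm1E eq_sym (negPf ix) mul0n.
by move: vb v1; rewrite negbK -(rk_eq0 sP) => /eqP->.
Qed.

End FaceLinear.

Section CanonicalLsop.
Variables (n : nat) (G : torus_graph n).
Implicit Types (e : edge G) (p : vert G) (F : face G).

Let sP := @face_simplicial n G.

Lemma vert_facet e : src e \in face_verts (facet_at e).
Proof. by apply: vert_face_at; rewrite subsetDl. Qed.

Lemma edge_facet e e' : src e' = src e -> (e' \in face_edges (facet_at e)) = (e' != e).
Proof.
by move=> se; rewrite edge_face_at ?subsetDl ?inE ?se ?eqxx ?andbT.
Qed.

Lemma rk_facet e : rk (facet_at e) = 1%N.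
Proof.
rewrite (rk_face (vert_facet e)); apply/eqP/cards1P; exists e; apply/setP => e'.
rewrite in_setD in_set1 [e' \in star _]inE; case: eqP => [se|ne].
  by rewrite edge_facet // andbT negbK.
by rewrite andbF; apply/esym/eqP => ee'; apply: ne; rewrite ee'.
Qed.

Lemma facet_inj e e' : src e = src e' -> facet_at e = facet_at e' -> e = e'.
Proof.
move=> se E; apply/eqP; have := edge_facet se; rewrite -E edge_facet // eqxx.
by move/esym/negbFE.
Qed.

(** The facets containing [F] correspond to the edges at [p] normal to [F]; the two sets have the
    same size by [rk_face]. *)
Lemma atoms_face F p : p \in face_verts F ->
  atoms F = [set facet_at e | e in star p :\: face_edges F].
Proof.
move=> pF; apply/esym/eqP; rewrite eqEcard card_in_imset; last first.
  move=> e e'; rewrite !in_setD ![_ \in star p]inE => /andP[_ /eqP se] /andP[_ /eqP se'].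
  by apply: facet_inj; rewrite se se'.
rewrite (card_atoms sP) (rk_face pF) leqnn andbT; apply/subsetP => _ /imsetP[e + ->].
rewrite in_setD [_ \in star p]inE => /andP[eF /eqP se]; apply/atomsP; split.
  exact: rk_facet.
rewrite (@le_face _ _ _ _ p) -?se ?vert_facet ?se // -se; apply/subsetP => e'.
rewrite in_setI [_ \in star _]inE => /andP[/eqP se' e'F]; rewrite edge_facet //.
by apply: contraNneq eF => <-.
Qed.

Lemma tau_facet e : tau (facet_at e) (src e) = lin (axial e).
Proof.
rewrite /tau vert_facet (big_pred1 e) // => e' /=; rewrite [e' \in star _]inE.
case: eqP => [/edge_facet->|ne]; first by rewrite negbK.
by apply/esym/eqP => ee'; apply: ne; rewrite ee'.
Qed.

Lemma tau_prod F p : p \in face_verts F -> \prod_(i in atoms F) tau i p = tau F p.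
Proof.
move=> pF; rewrite (atoms_face pF) big_imset /=; last first.
  move=> e e'; rewrite !in_setD ![_ \in star p]inE => /andP[_ /eqP se] /andP[_ /eqP se'].
  by apply: facet_inj; rewrite se se'.
rewrite /tau pF; apply: eq_big => [e|e]; first by rewrite in_setD andbC.
by rewrite in_setD [_ \in star p]inE => /andP[_ /eqP <-]; rewrite -tau_facet /tau.
Qed.

(** * Restriction to vertices and the classes [tau] *)

Lemma local_restriction p :
  exists Psi : {rmorphism face_ring (face G) -> {mpoly int[n]}},
    forall F, Psi (fv F) = tau F p.
Proof.
have [Psi PsiE] := face_ring_res sP (vertex_face p) (fun i => tau i p).
exists Psi => F; rewrite PsiE le_vertex_face.
by case: ifP => [/tau_prod//|pF]; rewrite /tau pF.
Qed.

(** If [e] is not in [F], both values are divisible by alpha(e). If it is, the connection matches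
    the normal edges at the two ends, and their labels agree modulo alpha(e). *)
Lemma tau_in_HT F e : exists c, tau F (src e) - tau F (tgt e) = c * lin (axial e).
Proof.
have lin_rev : exists z : int, lin (axial (Defs.rev e)) = z%:~R * lin (axial e).
  case: (axial_rev e) => ->; first by exists 1; rewrite mul1r.
  by exists (-1); rewrite raddfN mulrNz mulN1r.
have div e' : e' \notin face_edges F -> exists c, tau F (src e') = c * lin (axial e').
  move=> eF; rewrite /tau; case: ifP => _; last by exists 0; rewrite mul0r.
  by rewrite (bigD1 e') ?star_src //= mulrC; eexists.
have [eF|eF] := boolP (e \in face_edges F); last first.
  have [c ->] := div e eF; have [|c' c'E] := div (Defs.rev e).
    by apply: contra eF => /face_edge_rev; rewrite Defs.revK.
  have [z zE] := lin_rev; exists (c - c' * z%:~R).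
  by rewrite [tau F (tgt e)]c'E zE mulrBl mulrA.
rewrite /tau face_edge_src // face_edge_tgt //.
have -> : \prod_(e' in star (tgt e) | e' \notin face_edges F) lin (axial e') =
          \prod_(e' in star (src e) | e' \notin face_edges F) lin (axial (conn e e')).
  rewrite (eq_bigl (fun e' => e' \in conn e @: [set e' in star (src e) | e' \notin face_edges F])).
    rewrite big_imset /=; first by apply: eq_bigl => e'; rewrite inE.
    move=> e1 e2; rewrite !inE => /andP[/eqP s1 _] /andP[/eqP s2 _] E12.
    by rewrite -(connK s1) E12 connK.
  move=> e'; apply/andP/imsetP => [[]|[e'' + ->]].
    rewrite inE => /eqP se' e'F; exists (conn (Defs.rev e) e'); last by rewrite connKV.
    by rewrite !inE src_conn_rev // eqxx face_conn_iff // face_edge_rev.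
  by rewrite !inE => /andP[/eqP se'' e''F]; rewrite src_conn // eqxx face_conn_iff.
apply: prod_congr => e' /andP[]; rewrite inE => /eqP /axial_conn[c ->] _.
by exists (- c%:~R); rewrite raddfD /= linZ opprD addrA subrr sub0r mulNr mulrzl.
Qed.

(** The local restrictions assemble into one ring map. The congruence along an edge is stable under
    differences and products, so it suffices to check it on the generators. *)
Lemma identification_ex : exists Phi : {rmorphism face_ring (face G) ->
    {ffun vert G -> {mpoly int[n]}}}, is_identification Phi.
Proof.
have /choice[Psi PsiE] := local_restriction.
pose g x : {ffun vert G -> {mpoly int[n]}} := [ffun p => Psi p x].
have gB : zmod_morphism g.
  by move=> x y; apply/ffunP => p; rewrite !ffunE rmorphB.
have gM : monoid_morphism g.
  split; first by apply/ffunP => p; rewrite !ffunE rmorph1.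
  by move=> x y; apply/ffunP => p; rewrite !ffunE rmorphM.
pose Phi : {rmorphism face_ring (face G) -> {ffun vert G -> {mpoly int[n]}}} :=
  HB.pack g (GRing.isZmodMorphism.Build _ _ g gB) (GRing.isMonoidMorphism.Build _ _ g gM).
exists Phi; split=> [F p|x e]; first by rewrite -[Phi _]/(g _) ffunE PsiE.
rewrite -[Phi _]/(g _) !ffunE.
apply: (face_ring_ind (Q := fun x => exists c, Psi (src e) x - Psi (tgt e) x = c * lin (axial e))).
- move=> y z [c cE] [c' c'E]; exists (c - c'); rewrite !rmorphB mulrBl -cE -c'E; ring.
- move=> y z [c cE] [c' c'E]; exists (c * Psi (src e) z + Psi (tgt e) y * c').
  rewrite !rmorphM mulrDl -[_ * c' * _]mulrA -c'E mulrAC -cE; ring.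
- by move=> F; rewrite !PsiE; apply: tau_in_HT.
Qed.

(* Prescribed at one vertex of the face, the values propagate along its edges *)
(* by (iii).                                                                  *)
Lemma facet_functional F : exists l : 'cV[int]_n, forall p e,
  p \in face_verts F -> e \in star p -> pairing (axial e) l = (e \notin face_edges F)%:R.
Proof.
have [p pF] := face_vert_ex F; have [span _] := axial_basis p.
have /choice[c cE] (j : 'I_n) := span (delta_mx 0 j).
pose w e : int := (e \notin face_edges F)%:R.
(* [c j] holds the coordinates of the j-th standard vector in the basis at [p], so [l] adds up the
   coordinates of a vector along the edges normal to [F]. *)
pose l : 'cV[int]_n := \col_j \sum_(e in star p) c j e * w e.
have pairing_l (x : 'rV[int]_n) : pairing x l = \sum_(e in star p) (\sum_j x 0 j * c j e) * w e.
  rewrite /pairing mxE; under eq_bigr do rewrite mxE mulr_sumr.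
  rewrite exchange_big; apply: eq_bigr => e _; rewrite mulr_suml.
  by apply: eq_bigr => j _; rewrite mulrA.
exists l => q e qF eq; move: q qF e eq.
apply: (face_ind pF) => [e ep|e eF IH e'' ].
  have coefE : forall e', e' \in star p -> \sum_j axial e 0 j * c j e' = (e' == e)%:R.
    apply: (axial_basis_eq (c' := fun e' => (e' == e)%:R)).
    rewrite [RHS](bigD1 e) //= eqxx scale1r [X in _ + X]big1 ?addr0
      => [|e' /andP[_ /negPf->]]; last first.
      by rewrite scale0r.
    rewrite [RHS]row_sum_delta; under eq_bigr do rewrite scaler_suml.
    rewrite exchange_big; apply: eq_bigr => j _; rewrite [in RHS]cE scaler_sumr.
    by apply: eq_bigr => e' _; rewrite scalerA.
  rewrite pairing_l (bigD1 e) //= coefE // eqxx mul1r big1 ?addr0 // => e' /andP[e'p /negPf e'e].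
  by rewrite coefE // e'e mul0r.
rewrite inE => /eqP se''; have se' := src_conn_rev se''.
rewrite -(connKV se'') face_conn_iff //; have [z ->] := axial_conn se'.
rewrite pairingD pairingZ (IH _ (star_src _)) eF mulr0 addr0 IH //.
by rewrite inE se'.
Qed.

(** The facets through [p] are the [facet_at e] for [e] in the star, and the class of [facet_at e]
    has value alpha(e) at [p]; all other facets contribute zero. *)
Lemma local_lsop (l : face G -> 'cV[int]_n) p a :
  \sum_(v : face G | rk v == 1%N) tau v p *~ pairing a (l v) =
  lin (\sum_(e in star p) pairing a (l (facet_at e)) *: axial e).
Proof.
rewrite raddf_sum (bigID (fun v => p \in face_verts v)) /= [X in _ + X]big1 ?addr0; last first.
  by move=> v /andP[_ /negPf pv]; rewrite /tau pv mul0rz.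
have facet_in : {in star p &, injective (@facet_at n G)}.
  by move=> e e'; rewrite ![_ \in star p]inE => /eqP se /eqP se'; apply: facet_inj; rewrite se se'.
rewrite (eq_bigl (fun v => v \in @facet_at n G @: star p)) => [|v]; last first.
  apply/andP/imsetP => [[/eqP v1 pv]|[e + ->]]; last first.
    by rewrite [_ \in star p]inE => /eqP <-; rewrite rk_facet vert_facet.
  have : v \in atoms v by apply/atomsP.
  rewrite (atoms_face pv) => /imsetP[e]; rewrite in_setD => /andP[_ ep] ->.
  by exists e.
rewrite big_imset //=; apply: eq_bigr => e; rewrite [_ \in star p]inE => /eqP <-.
by rewrite linZ tau_facet.
Qed.

Section Lambda.
Variable l : face G -> 'cV[int]_n.
Hypothesis lE : forall F p e, p \in face_verts F -> e \in star p ->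
  pairing (axial e) (l F) = (e \notin face_edges F)%:R.

Lemma pairing_facet p e e' : e \in star p -> e' \in star p ->
  pairing (axial e) (l (facet_at e')) = (e == e')%:R.
Proof.
rewrite ![_ \in star p]inE => /eqP ep /eqP e'p.
rewrite (lE (vert_facet e')) ?inE ?ep ?e'p //.
by rewrite edge_facet ?negbK ?ep ?e'p.
Qed.

Lemma facet_expand p a : \sum_(e in star p) pairing a (l (facet_at e)) *: axial e = a.
Proof.
have [c cE] := proj1 (axial_basis p) a; rewrite [RHS]cE.
apply: eq_bigr => e ep; congr (_ *: _); rewrite cE pairing_sum (bigD1 e) //= big1 ?addr0.
  by rewrite pairingZ (pairing_facet ep) // eqxx mulr1.
by move=> e' /andP[e'p /negPf ee']; rewrite pairingZ (pairing_facet e'p) // ee' mulr0.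
Qed.

Lemma tau_linear_form p a (Psi : {rmorphism face_ring (face G) -> {mpoly int[n]}}) :
  (forall F, Psi (fv F) = tau F p) -> Psi (linear_form l a) = lin a.
Proof.
move=> PsiE; rewrite rmorph_sum -[in RHS](facet_expand p a) -local_lsop //.
by apply: eq_bigr => v _; rewrite rmorphMz PsiE.
Qed.

(** Restriction to a vertex sends the j-th form to the j-th variable, which gives independence. For
    finiteness, the forms of the vectors [axial e] have the dual coefficients that [face_ring_fg]
    requires. *)
Lemma canonical_is_lsop : is_lsop (fun j : 'I_n => linear_form l (row j 1%:M)).
Proof.
set th := fun j => _.
have thE j : th j = linear_form l (delta_mx 0 j) by rewrite /th row1.
have ev_lin a : eval_at th (lin a) = linear_form l a.
  rewrite /eval_at /lin rmorph_sum {2}[a]row_sum_delta raddf_sum; apply: eq_bigr => j _.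
  rewrite /= mmapZ mmapX mmap1U thE mulrzl; by rewrite -[a 0 j in RHS]intz scaler_int raddfMz.
split.
- by move=> j; apply: homogeneous_linear_form sP.
- move=> q q0; have [p _] := face_vert_ex (whole_face G).
  have [Psi PsiE] := local_restriction p.
  suff <- : Psi (eval_at th q) = q by rewrite q0 rmorph0.
  rewrite {q0}/eval_at; elim/mpolyind: q => [|c m q _ _ IH]; first by rewrite !rmorph0.
  rewrite !rmorphD IH; congr (_ + _); rewrite /= mmapZ rmorphM rmorph_int.
  rewrite mmapX /mmap1 rmorph_prod.
  rewrite -mul_mpolyC -[in RHS](intz c) rmorph_int; congr (_ * _).
  rewrite [RHS]mpolyXE_id; apply: eq_bigr => j _.
  by rewrite rmorphXn /= thE (tau_linear_form _ PsiE) lin_delta.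
- pose A : {rmorphism {mpoly int[n]} -> face_ring (face G)} := mmap intr th.
  have dual F i : i \in atoms F -> exists q, exists2 c : face G -> int,
      A q = \sum_(v | rk v == 1%N) fv v *~ c v & forall j, j \in atoms F -> c j = (j == i)%:R.
    have [p pF] := face_vert_ex F; rewrite (atoms_face pF) => /imsetP[e].
    rewrite in_setD => /andP[_ ep] ->.
    exists (lin (axial e)), (fun v => pairing (axial e) (l v)); first exact: ev_lin.
    move=> _ /imsetP[e' + ->]; rewrite in_setD => /andP[_ e'p].
    rewrite (pairing_facet ep) //; congr (nat_of_bool _)%:R; apply/eqP/eqP => [->//|].
    move: ep e'p; rewrite ![_ \in star p]inE => /eqP ep /eqP e'p /facet_inj -> //.
    by rewrite ep e'p.
  exists #|{: face G}|, (fun k => fv (enum_val k)) => x.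
  have [q ->] := face_ring_fg sP dual x; exists (fun k => q (enum_val k)).
  rewrite (reindex (fun k : 'I_#|{: face G}| => enum_val k)) //.
  exact/onW_bij/enum_val_bij.
Qed.

Lemma canonical_linear_form : is_lsop_hom (linear_form l).
Proof. by exists 1%:M; [apply: unitmx1|apply: canonical_is_lsop]. Qed.

End Lambda.

Lemma functional_ex : exists l : face G -> 'cV[int]_n, forall F p e,
  p \in face_verts F -> e \in star p -> pairing (axial e) (l F) = (e \notin face_edges F)%:R.
Proof. by have /choice[l lE] := facet_functional; exists l => F p e; apply: lE. Qed.

Lemma lsop_ex : exists th : 'I_n -> face_ring (face G), is_lsop th.
Proof. by have [l lE] := functional_ex; eexists; apply: canonical_is_lsop lE. Qed.

Lemma identification_at Phi p : is_identification Phi ->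
  exists2 Psi : {rmorphism face_ring (face G) -> {mpoly int[n]}},
    forall F, Psi (fv F) = tau F p & forall x, Psi x = Phi x p.
Proof.
move=> [PhiE _]; pose g x := Phi x p.
have gB : zmod_morphism g by move=> x y; rewrite /g rmorphB !ffunE.
have gM : monoid_morphism g.
  by split=> [|x y]; rewrite /g ?rmorph1 ?rmorphM !ffunE.
pose Psi : {rmorphism face_ring (face G) -> {mpoly int[n]}} :=
  HB.pack g (GRing.isZmodMorphism.Build _ _ g gB) (GRing.isMonoidMorphism.Build _ _ g gM).
by exists Psi => // F; rewrite -PhiE.
Qed.

Lemma canonical_lsop_ex Phi : is_identification Phi ->
  exists lam : {additive 'rV[int]_n -> face_ring (face G)}, is_canonical_lsop Phi lam.
Proof.
have [l lE] := functional_ex => PhiE; exists (linear_form l).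
split=> [|t p]; first exact: canonical_linear_form.
have [Psi PsiE <-] := identification_at p PhiE; exact: tau_linear_form.
Qed.

(** Labels at one vertex remain distinct modulo any one of them; with condition (iii), this pins
    down the connection. *)
Lemma axial_inj_mod p e1 e2 e3 z : e1 \in star p -> e2 \in star p -> e3 \in star p ->
  axial e1 = axial e2 + z *: axial e3 -> e1 = e2.
Proof.
move=> e1p e2p e3p E.
have sum1 e0 (y : int) : e0 \in star p ->
    \sum_(e in star p) (y * (e == e0)%:R) *: axial e = y *: axial e0.
  move=> e0p; rewrite (bigD1 e0) //= eqxx mulr1 big1 ?addr0 // => e /andP[_ /negPf->].
  by rewrite mulr0 scale0r.
have /(axial_basis_eq (p := p)) coefE : \sum_(e in star p) (1 * (e == e1)%:R) *: axial e =
    \sum_(e in star p) (1 * (e == e2)%:R + z * (e == e3)%:R) *: axial e.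
  rewrite sum1 // scale1r E -[axial e2]scale1r -!sum1 // -big_split.
  by apply: eq_bigr => e _; rewrite scalerDl.
apply/eqP; apply: contrapT => /negP/negPf ne.
have := coefE _ e1p; have := coefE _ e2p; rewrite eqxx (eq_sym e2) eqxx ne !mul1r.
have [<-|_] := eqVneq e2 e3; first by rewrite ne mulr0 addr0.
by rewrite mulr0 addr0.
Qed.

End CanonicalLsop.

(** * Reconstruction *)

Section Reconstruction.
Variables (n : nat) (G : torus_graph n).
Notation Gm := (Gamma (face G) n).
Variables (Phi : {rmorphism face_ring (face G) -> {ffun vert G -> {mpoly int[n]}}}).
Hypothesis PhiE : is_identification Phi.
Variables (lam : {additive 'rV[int]_n -> face_ring (face G)}).
Hypothesis lamP : is_canonical_lsop Phi lam.
Variables (alpha : edge Gm -> 'rV[int]_n) (theta : edge Gm -> edge Gm -> edge Gm).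
Hypothesis alphaP : constructed_axial lam alpha.
Hypothesis thetaP : is_torus_graph alpha theta.

Lemma reconstruction : equals_torus_graph alpha theta.
Proof.
have sP := @face_simplicial n G; have pm := face_pseudomanifold G.
have /choice[fV fVE] : forall x : vert Gm, exists p, val x = vertex_face p.
  move=> x; have [p px] := face_vert_ex (val x); exists p.
  by apply: rk_top_face => //; apply: rk_top.
have fV_in (e : edge Gm) : fV (src e) \in face_verts (flag_wall e).
  by rewrite -le_vertex_face -fVE; apply: wall_src.
(* A wall is a 1-face, and the source of [e] is one of its ends; together they select an oriented
   edge. *)
have /choice[fE fEP] : forall e : edge Gm, exists e0,
    e0 \in face_edges (flag_wall e) /\ src e0 = fV (src e).
  by move=> e; have [e0 ? ?] := rk1_edge (rk_wall e) (fV_in e); exists e0.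
have fE_in (e : edge Gm) : fE e \in face_edges (flag_wall e) by case: (fEP e).
have fE_src e : src (fE e) = fV (src e) by case: (fEP e).
have fV_inj : injective fV by move=> x y xy; apply: val_inj; rewrite !fVE xy.
have fE_uniq (e : edge Gm) e0 :
    e0 \in face_edges (flag_wall e) -> src e0 = fV (src e) -> e0 = fE e.
  move=> e0w se0; have /setP/(_ e0) := edge_face_star (rk_wall e) (fE_in e).
  by rewrite in_setI [_ \in star _]inE fE_src se0 eqxx e0w inE => /esym/eqP.
have fE_rev e : fE (Defs.rev e) = Defs.rev (fE e).
  apply/esym/fE_uniq; first by rewrite wall_rev face_edge_rev.
  have [VE _] := edges_rk1 (rk_wall e) (fE_in e).
  have := fV_in (Defs.rev e); rewrite wall_rev VE => /set2P[|->//].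
  by rewrite fE_src => /fV_inj E; have := loopless e; rewrite E eqxx.
have fE_inj : injective fE.
  move=> e e' ee'; have se : src e = src e' by apply: fV_inj; rewrite -!fE_src ee'.
  apply: (edge_wall_inj pm se).
  apply: (face_eq (fV_in e)); first by rewrite se fV_in.
  rewrite -fE_src (edge_face_star (rk_wall e)) // ee' (edge_face_star (rk_wall e')) //.
have fV_surj p : exists x, fV x = p.
  exists (Sub (vertex_face p) (introT eqP (rk_vertex_face p)) : top_simplex (face G) n).
  by apply: vertex_face_inj; rewrite -fVE.
have fE_surj e0 : exists e, fE e = e0.
  have [x xE] := fV_surj (src e0).
  have [||e es ew] := edge_wall_ex pm (w := edge_face e0) (s := x).
  - exact: rk_edge_face.
  - by rewrite fVE le_vertex_face xE face_edge_src // edge_face_mem.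
  by exists e; apply/esym/fE_uniq; rewrite ?ew ?edge_face_mem ?es ?xE.
have bij_of (A B : Type) (f : A -> B) : injective f -> (forall y, exists x, f x = y) -> bijective f.
  by move=> fi /choice[g gK]; exists g => // x; apply: fi; rewrite gK.
have [l lamE lP] := alphaP.
(* Evaluating [Phi (lam a)] at [p] by the coefficients [l] must give [lin a], and [lin] is
   injective. So any admissible [l] is dual to the labels at [p]. *)
have expand p a : \sum_(e0 in star p) pairing a (l (facet_at e0)) *: axial e0 = a.
  have [Psi PsiE PsiP] := identification_at p PhiE.
  apply: lin_inj; rewrite -local_lsop // -(proj2 lamP _ p) -PsiP lamE rmorph_sum.
  by apply: eq_bigr => v _; rewrite rmorphMz PsiE.
have axialE e : axial (fE e) = alpha e.
  set p := fV (src e).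
  have ep : fE e \in star p by rewrite inE fE_src.
  have pairE e0 : e0 \in star p -> pairing (alpha e) (l (facet_at e0)) = (e0 == fE e)%:R.
    rewrite inE => /eqP e0p; have sE : src e0 = src (fE e) by rewrite fE_src.
    rewrite (lP e _ (facet_at (fE e))) ?rk_facet ?fVE ?le_vertex_face //.
    - by congr (nat_of_bool _)%:R; apply/eqP/eqP => [/facet_inj->|->].
    - by rewrite -/p -e0p vert_facet.
    - by rewrite -fE_src vert_facet.
    rewrite leFE negb_and; apply/orP; right; apply/subsetPn; exists (fE e) => //.
    by rewrite edge_facet ?eqxx.
  rewrite -(expand p (alpha e)) (bigD1 (fE e)) //= big1 ?addr0 => [|e0 /andP[e0p /negPf e0e]].
    by rewrite pairE // eqxx scale1r.
  by rewrite pairE // e0e scale0r.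
exists fV, fE; split.
- by split; apply: bij_of.
- by move=> x; rewrite fVE verts_vertex_face.
- by move=> e; have [_] := edges_rk1 (rk_wall e) (fE_in e).
- by move=> e; split.
- split=> // e e' se.
  have [_ _ [th_src _ _] [_ _ th_ax]] := thetaP.
  have [c cE] := th_ax e e' se.
  have se0 : src (fE e') = src (fE e) by rewrite !fE_src se.
  have [c' c'E] := axial_conn se0.
  have st : src (fE (theta e e')) = tgt (fE e).
    by rewrite fE_src th_src // /tgt -fE_rev fE_src.
  have [z zE] : exists z, axial (fE e) = z *: axial (Defs.rev (fE e)).
    case: (axial_rev (fE e)) => ->; first by exists 1; rewrite scale1r.
    by exists (-1); rewrite scaleN1r opprK.
  (* Both edges start at [tgt (fE e)], and their labels differ by c' - c times [axial (fE e)]; the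
     sign [z] expresses this through the reversed edge, which also starts there. *)
  apply: (@axial_inj_mod _ _ (tgt (fE e)) _ _ (Defs.rev (fE e)) ((c' - c) * z)).
  - by rewrite inE src_conn.
  - by rewrite inE st.
  - by rewrite inE.
  have alE : alpha (theta e e') = alpha e' + c *: alpha e by rewrite -cE addrC subrK.
  rewrite -scalerA -zE c'E [axial (fE (theta e e'))]axialE alE -!axialE.
  by rewrite -addrA -scalerDl (addrC c) subrK.
Qed.

End Reconstruction.

Theorem theorem7p1 :
  [/\ (forall (n : nat) (G : torus_graph n),
         pseudomanifold (face G) n /\
         exists th : 'I_n -> face_ring (face G), is_lsop th),
      (forall (n : nat) (d : Order.disp_t) (P : finBPOrderType d)
              (lam : {additive 'rV[int]_n -> face_ring P}),
         pseudomanifold P n -> is_lsop_hom lam ->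
         exists alpha : edge (Gamma P n) -> 'rV[int]_n,
           [/\ constructed_axial lam alpha,
               (forall alpha', constructed_axial lam alpha' -> alpha' =1 alpha) &
               exists theta, is_torus_graph alpha theta]) &
      (forall (n : nat) (G : torus_graph n),
         exists2 Phi : {rmorphism face_ring (face G) ->
                                  {ffun vert G -> {mpoly int[n]}}},
           is_identification Phi &
           (exists lam : {additive 'rV[int]_n -> face_ring (face G)},
              is_canonical_lsop Phi lam) /\
           (forall (lam : {additive 'rV[int]_n -> face_ring (face G)}) alpha theta,
              is_canonical_lsop Phi lam -> constructed_axial lam alpha ->
              is_torus_graph alpha theta -> equals_torus_graph alpha theta))].
Proof.
split=> [n G|n d P lam pmP lamP|n G].
- by split; [exact: face_pseudomanifold|exact: lsop_ex].
- exact: torus_graph_of_poset.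
have [Phi PhiE] := identification_ex G; exists Phi => //.
split; first exact: canonical_lsop_ex.
by move=> lam alpha theta lamP alphaP thetaP; apply: (reconstruction PhiE lamP).
Qed.
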